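(* Let $G$ be a sharply triply transitive permutation group of odd characteristic. Suppose that the stabilizer of a point in $G$ has a regular abelian normal subgroup, and that each finite subgroup of this point stabilizer is contained in a finite non-solvable subgroup of $G$. Then $G$ is locally finite.
   Context: A permutation group $G$ of a set $X$ with $|X|\ge 3$ is sharply triply transitive if for any two ordered triples $(\alpha_1,\alpha_2,\alpha_3)$ and $(\beta_1,\beta_2,\beta_3)$, each consisting of pairwise distinct elements of $X$, there is exactly one element of $G$ taking $\alpha_i$ to $\beta_i$ for $i=1,2,3$. Sharply doubly transitive is defined in the same way with pairs. For $\alpha\in X$ the stabilizer $G_\alpha$ is then a sharply doubly transitive permutation group of $X\setminus\{\alpha\}$; ''regular'' for a subgroup of $G_\alpha$ means acting regularly (sharply transitively) on $X\setminus\{\alpha\}$. Characteristic of a sharply doubly transitive group $T$: an involution is an element of order $2$. If a point stabilizer in $T$ contains no involution, then $\mathrm{Char}\,T=2$. If it contains an involution, then it is known that all products of two distinct involutions of $T$ are conjugate in $T$ and have either the same odd prime order $p$, in which case $\mathrm{Char}\,T=p$, or infinite order, in which case $\mathrm{Char}\,T=0$. The characteristic of a sharply triply transitive group $G$ is the characteristic of its point stabilizer $G_\alpha$ as a sharply doubly transitive group on $X\setminus\{\alpha\}$; odd characteristic means that it is an odd prime. A group is locally finite if all its finitely generated subgroups are finite. *)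

(* Defs.v *)
From HB Require Import structures.
From mathcomp Require Import all_boot.
From mathcomp Require Import boolp classical_sets functions cardinality.

Set Implicit Arguments.
Unset Strict Implicit.
Unset Printing Implicit Defensive.

Local Open Scope classical_set_scope.
Local Open Scope group_scope.

(* [{perm X}] only exists for a finite [X]; [sym X] is the symmetric group of an
   arbitrary type. The inverse is uniquely determined by the function ([symP]). *)
Record sym (X : Type) := Sym {
  sym_fun :> X -> X;
  sym_inv : X -> X;
  sym_funK : cancel sym_fun sym_inv;
  sym_invK : cancel sym_inv sym_fun }.

Section SymGroup.
Variable X : Type.
Implicit Types s t u : sym X.

Lemma symP s t : (forall x, s x = t x) -> s = t.
Proof.
case: s t => [f f' fK f'K] [g g' gK g'K] /= fg.
have Efg : f = g by apply: funext.
subst g.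
have Efg' : f' = g' by apply: funext => x; rewrite -{1}[x]g'K fK.
subst g'.
by congr Sym; apply: Prop_irrelevance.
Qed.

HB.instance Definition _ := gen_eqMixin (sym X).
HB.instance Definition _ := gen_choiceMixin (sym X).

Definition sym_one : sym X := @Sym X id id (frefl _) (frefl _).

(* Left-to-right composition, as for [{perm T}]: (s * t) x = t (s x). *)
Definition sym_mul s t : sym X :=
  @Sym X (t \o s) (sym_inv s \o sym_inv t)
    (can_comp (@sym_funK X t) (@sym_funK X s))
    (can_comp (@sym_invK X s) (@sym_invK X t)).

Definition sym_opp s : sym X := Sym (@sym_invK X s) (@sym_funK X s).

Lemma sym_mulA : associative sym_mul. Proof. by move=> s t u; apply: symP. Qed.
Lemma sym_mul1 : left_id sym_one sym_mul. Proof. by move=> s; apply: symP. Qed.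
Lemma sym_mulr1 : right_id sym_one sym_mul. Proof. by move=> s; apply: symP. Qed.
Lemma sym_mulV : left_inverse sym_one sym_opp sym_mul.
Proof. by move=> s; apply: symP => x; apply: sym_invK. Qed.
Lemma sym_mulrV : right_inverse sym_one sym_opp sym_mul.
Proof. by move=> s; apply: symP => x; apply: sym_funK. Qed.

HB.instance Definition _ :=
  isGroup.Build (sym X) sym_mulA sym_mul1 sym_mulr1 sym_mulV sym_mulrV.

End SymGroup.

Section GroupNotions.
Variable gT : groupType.
Implicit Types (G H N S : set gT) (g : gT) (n : nat).

Definition is_subgroup H : Prop :=
  [/\ H 1, forall x y, H x -> H y -> H (x * y) & forall x, H x -> H x^-1].

Definition generated S : set gT := smallest is_subgroup S.

Definition is_abelian H : Prop := forall x y, H x -> H y -> x * y = y * x.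

Definition is_normal N G : Prop :=
  [/\ is_subgroup N, N `<=` G & forall x g, N x -> G g -> N (x ^ g)].

Definition derived H : set gT :=
  generated [set [~ z.1, z.2] | z in H `*` H].

Definition is_solvable H : Prop := exists n, iter n derived H = [set 1].

Definition is_locally_finite G : Prop :=
  forall S, finite_set S -> S `<=` G -> finite_set (generated S).

Definition has_order g n : Prop :=
  [/\ 0 < n, g ^+ n = 1 & forall m, 0 < m < n -> g ^+ m <> 1].

Definition infinite_order g : Prop := forall n, 0 < n -> g ^+ n <> 1.

Definition involution g : Prop := has_order g 2.

End GroupNotions.

Section PermutationGroups.
Variable X : Type.
Implicit Types (G T N : set (sym X)) (Y : set X).

Definition stabilizer G (a : X) : set (sym X) := [set g | G g /\ g a = a].

Definition is_regular N Y : Prop :=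
  forall x y, Y x -> Y y -> exists! g, N g /\ g x = y.

Definition sharply_triply_transitive G : Prop :=
  [/\ is_subgroup G,
      exists a b c : X, [/\ a <> b, a <> c & b <> c]
    & forall a1 a2 a3 b1 b2 b3 : X,
        a1 <> a2 -> a1 <> a3 -> a2 <> a3 ->
        b1 <> b2 -> b1 <> b3 -> b2 <> b3 ->
        exists! g, G g /\ [/\ g a1 = b1, g a2 = b2 & g a3 = b3]].

(* [sharp2_char T Y n]: the group [T], acting sharply doubly transitively on
   [Y], has characteristic [n]. Stated as a relation because the characteristic
   is well defined only by a theorem. Such a [T] has two distinct involutions as
   soon as a point stabilizer contains one, so the last two clauses are never
   vacuous and [n] is unique. *)
Inductive sharp2_char T Y : nat -> Prop :=
| Char_two of
    ~ (exists y g, [/\ Y y, stabilizer T y g & involution g]) :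
    sharp2_char T Y 2
| Char_odd p of
    (exists y g, [/\ Y y, stabilizer T y g & involution g]) &
    prime p & odd p &
    (forall s t, T s -> T t -> involution s -> involution t -> s <> t ->
       has_order (s * t) p) :
    sharp2_char T Y p
| Char_zero of
    (exists y g, [/\ Y y, stabilizer T y g & involution g]) &
    (forall s t, T s -> T t -> involution s -> involution t -> s <> t ->
       infinite_order (s * t)) :
    sharp2_char T Y 0.

(* All point stabilizers of a transitive group are conjugate, hence [exists]. *)
Definition sharp3_char G n : Prop :=
  exists a, sharp2_char (stabilizer G a) [set~ a] n.

Definition odd_characteristic G : Prop :=
  exists p, [/\ prime p, odd p & sharp3_char G p].

End PermutationGroups.

(* Main.v *)
(* Fix [b <> a]. The group [N] is elementary abelian of odd exponent [p] and regular on the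
   points other than [a], so [G_ab] acts on it without fixed points, and the unique involution
   [z] of [G_ab] inverts [N]. If [t] swaps [a] and [b] and fixes [e], and [u] in [G_a] swaps
   [b] and [e], then [t u t = u t u]; this relation forces the involution [t] to invert every
   element of order 3 of [G_ab], hence elements of order 3 of [G_ab] commute.

   Finite subgroups of [G_a] that contain [z] and meet [N] nontrivially are solvable: a nontrivial
   perfect Frobenius complement has quaternion Sylow 2-subgroups, whose fusion produces an
   element of order 3; by commutation it generates a normal, hence central, subgroup,
   which contradicts transfer at the prime 3. So a finite non-solvable subgroup [H] of [G] that
   contains [z] and more than three elements of [N] must move [a]. Counting the fixed points of
   its involutions shows that the orbit of [a] under [H] is [a] together with [b ^ (N :&: H)],
   and so [H] contains the involutions fixing any two points of this orbit.

   Hence the subgroup generated by all involutions with fixed points is locally finite. Counting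
   involutions that swap [a] and [b] shows that it has index at most 2 in [G], so [G] is locally
   finite as well. *)

From HB Require Import structures.
Require Import Defs.
From mathcomp Require Import all_boot all_fingroup all_solvable.
From mathcomp Require Import ssralg finalg zify.

Set Implicit Arguments.
Unset Strict Implicit.
Unset Printing Implicit Defensive.

Local Open Scope group_scope.

(** * Perfect groups and transfer *)

(** The transfer into the abelian group [alpha @* S] vanishes on the perfect group [G]. Since
    [alpha] is constant on fusion classes, the transfer of [x] is [alpha x] to the power [#|G : S|],
    which is prime to [p]. *)
Lemma perfect_transfer (gT aT : finGroupType) (G S : {group gT}) p
    (alpha : {morphism S >-> aT}) :
    p.-Sylow(G) S -> G \subset G^`(1) -> abelian (alpha @* S) ->
    (forall x u, x \in S -> u \in G -> x ^ u \in S -> alpha (x ^ u) = alpha x) ->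
  alpha @* S = 1.
Proof.
move=> sylS perfG abA fusion; have sSG := pHall_sub sylS.
pose V := transfer_morphism G abA.
have VG1 : V @* G = 1.
  apply/trivgP; apply: subset_trans (morphimS _ perfG) _.
  by rewrite morphim_der //; apply/der1_min;
    rewrite ?norms1 // quotient_abelian ?FinRing.zmod_abelian.
have trG1 g : g \in G -> transfer G abA g = 0%R.
  move=> Gg; have := mem_morphim V Gg Gg; rewrite VG1 => /set1gP; exact.
apply/trivgP/subsetP=> _ /morphimP[x _ Sx ->].
have Gx := subsetP sSG x Sx.
have trX := transversalP (rcosets_cycle_partition sSG Gx).
have /esym := trG1 x Gx; rewrite (transfer_cycle_expansion sSG abA Gx trX).
have Sn y : y \in G -> (x ^+ #|<[x]> : S :* y|) ^ y^-1 \in S.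
  move=> Gy; have := mulg_exp_card_rcosets S x y.
  by rewrite mem_rcoset /conjg invgK mulgA.
have sXG := subsetP (transversal_sub trX).
rewrite (eq_bigr (fun y => FiniteModule.fmod abA (alpha x) *+ #|<[x]> : S :* y|)%R); last first.
  move=> y Xy; have Gy := sXG y Xy.
  rewrite /restrm /= (fusion _ y^-1) ?groupX ?groupV ?Sn //.
  by rewrite morphX // FiniteModule.fmodX // mem_morphim.
rewrite GRing.sumrMnr (sum_index_rcosets_cycle sSG Gx trX).
move=> /(congr1 (@FiniteModule.fmval _ _ abA)).
rewrite FiniteModule.fmvalZ FiniteModule.fmodK ?mem_morphim // FiniteModule.fmval0.
move=> /esym/eqP; rewrite -order_dvdn => dvd.
rewrite inE -order_eq1 -dvdn1 -(gcdnn #[alpha x]).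
have : coprime #[alpha x] #|G : S|.
  apply: (@coprime_dvdl _ #|S|);
    first by rewrite (dvdn_trans _ (order_dvdG Sx)) // order_dvdn -morphX // expg_order morph1.
  by have /and3P[_ pS p'] := sylS; apply: pnat_coprime pS p'.
by rewrite /coprime => /eqP <-; rewrite gcdnn dvdn_gcd dvdnn.
Qed.

(** Burnside's argument: if [x] and [x ^ u] lie in the abelian group [R], then [R] and [R :^ u] are
    Sylow in the centralizer of [x ^ u], so ['N_G(R)] controls fusion in [R]. Here that fusion is
    trivial, and [perfect_transfer] applies to the identity of [R]. *)
Lemma perfect_abelian_Sylow (gT : finGroupType) (G R : {group gT}) p :
    p.-Sylow(G) R -> G \subset G^`(1) -> abelian R -> 'N_G(R) \subset 'C(R) ->
  R :=: 1.
Proof.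
move=> sylR perfG abR sNC; have sRG := pHall_sub sylR.
have im: idm R @* R = R by rewrite morphim_idm.
rewrite -[RHS](@perfect_transfer _ _ G R p (idm_morphism R) sylR perfG) ?im //.
move=> x u Rx Gu Rxu /=.
have sylC (y : gT) (Q : {group gT}) : p.-Sylow(G) Q -> Q \subset 'C[y] -> p.-Sylow('C_G[y]) Q.
  move=> sylQ cQ; have sQG := pHall_sub sylQ.
  by apply: pHall_subl sylQ; rewrite ?subsetIl // subsetI sQG.
have cR (y : gT) : y \in R -> R \subset 'C[y].
  by move=> Ry; rewrite sub_cent1; apply: subsetP abR _ Ry.
have sylR1 := sylC _ _ sylR (cR _ Rxu).
have sylR2 : p.-Sylow('C_G[x ^ u]) (R :^ u).
  apply: sylC; first by rewrite pHallJ.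
  by rewrite cent1J conjSg cR.
have [v /setIP[Gv Cv] defR] := Sylow_trans sylR2 sylR1.
have Nuv : u * v \in 'N_G(R).
  by rewrite inE groupM //= -(normsP (normG R) 1) // inE conjsg1 conjsgM -defR.
have cRuv := centP (subsetP sNC _ Nuv) x Rx.
have: x ^ (u * v) = x by rewrite /conjg -cRuv mulKg.
by rewrite conjgM /conjg -(cent1P Cv) mulKg.
Qed.

(* The sum of [v ^ h] over the elements [h = x ^+ i * y ^+ (i * j)] is computed in two ways:
   along the cyclic groups [<[x * y ^+ j]>] it vanishes, along the [i] only [i = 0] survives. *)
Lemma semiregular_rank (gT : finGroupType) (V C : {group gT}) r :
    prime r -> abelian V -> V :!=: 1 -> C \subset 'N(V) -> semiregular V C ->
  'r_r(C) <= 1.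
Proof.
move=> pr_r abV ntV nVC regVC; rewrite leqNgt; apply/negP=> /p_rank_geP[E].
case/pnElemP=> sEC abelE dimE; have r_gt1 := prime_gt1 pr_r.
have [rE abE _] := and3P abelE.
have oE : #|E| = (r ^ 2)%N by rewrite (card_pgroup rE) dimE.
have Er x : x \in E -> x ^+ r = 1 by case/(abelemP pr_r): abelE => _; apply.
have [x Ex ntx] : exists2 x, x \in E & x != 1.
  by apply/trivgPn; rewrite trivg_card1 oE; case: r r_gt1 {pr_r abelE dimE rE oE Er} => [|[]].
have ox : #[x] = r by apply: nt_prime_order; rewrite ?Er.
have [y Ey notXy] : exists2 y, y \in E & y \notin <[x]>.
  apply/subsetPn; apply/negP=> /subset_leq_card; rewrite oE -orderE ox.
  by rewrite leqNgt -{1}(expn1 r) ltn_exp2l.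
have NVE g : g \in E -> g \in 'N(V) by move=> Eg; rewrite (subsetP nVC) ?(subsetP sEC).
pose f g v := (\sum_(i < r) FiniteModule.actr v (g ^+ i))%R : FiniteModule.fmod_of abV.
(* This trace is fixed by [g], hence zero by semiregularity. *)
have f0 g v : g \in E -> g != 1 -> f g v = 0%R.
  move=> Eg ntg.
  have fg : FiniteModule.actr (f g v) g = f g v.
    rewrite /f FiniteModule.actr_sum -(prednK (prime_gt0 pr_r)).
    rewrite big_ord_recr big_ord_recl /= GRing.addrC expg0 FiniteModule.actr1.
    rewrite -FiniteModule.actrM ?groupX ?NVE // -expgSr prednK ?prime_gt0 // Er //.
    rewrite FiniteModule.actr1; congr (_ + _)%R; apply: eq_bigr => i _.
    by rewrite -FiniteModule.actrM ?groupX ?NVE // -expgSr.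
  apply: val_inj => /=; apply/set1gP; rewrite -(regVC g); last by rewrite !inE ntg (subsetP sEC).
  have := FiniteModule.fmvalJ (f g v) (NVE g Eg).
  rewrite fg inE FiniteModule.fmodP /=; set w := FiniteModule.fmval _ => wg.
  by apply/cent1P; rewrite /commute conjgC -wg.
have [v Vv ntv] := trivgPn _ ntV.
pose u := FiniteModule.fmod abV v.
have xyE j : x * y ^+ j \in E by rewrite groupM ?groupX.
have cxy : commute x y by apply: (centsP abE).
have nty : y != 1 by apply: contraNneq (notXy) => ->; apply: group1.
have oy : #[y] = r by apply: nt_prime_order; rewrite ?Er.
have gen_y k : coprime r k -> y \in <[y ^+ k]>.
  by rewrite -{1}oy -generator_coprime => /eqP defY; rewrite -cycle_subG {1}defY.
have ntxy j : x * y ^+ j != 1.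
  apply: contra (notXy) => /eqP xy1; have [j0|] := boolP (r %| j).
    by rewrite -(divnK j0) mulnC expgM Er // expg1n mulg1 in xy1; rewrite xy1 eqxx in ntx.
  rewrite -prime_coprime // => /gen_y.
  by rewrite -(mulKg x (y ^+ j)) xy1 mulg1 cycleV -cycle_subG cycle_subG.
have : (\sum_(j < r) f (x * y ^+ j)%g u)%R = 0%R by apply: big1 => j _; apply: f0.
rewrite /f exchange_big /= -(prednK (prime_gt0 pr_r)) big_ord_recl /=.
rewrite [X in (_ + X)%R]big1 ?GRing.addr0.
  under eq_bigr do rewrite expg0 FiniteModule.actr1.
  rewrite GRing.sumr_const card_ord prednK ?prime_gt0 // =>
    /(congr1 (@FiniteModule.fmval _ _ abV)).
  rewrite FiniteModule.fmvalZ FiniteModule.fmodK // FiniteModule.fmval0 => /eqP.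
  rewrite -order_dvdn => dvd_r; case/negP: ntv; rewrite -order_eq1 -dvdn1.
  have /eqP <- : coprime #[v] r.
    apply: coprime_dvdl (order_dvdG Vv) _; rewrite -ox.
    apply: coprime_dvdr (order_dvdG (subsetP sEC _ Ex)) _.
    exact: regular_norm_coprime nVC regVC.
  by rewrite dvdn_gcd dvdnn.
(* For the exponent [i.+1], prime to [r], the sum over [j] is the trace under [y ^+ i.+1] of an
   image of [u]. *)
move=> i _; have co_i : coprime r i.+1.
  by rewrite prime_coprime // gtnNdvd // -[leqRHS](prednK (prime_gt0 pr_r)) ltnS.
have /(f0 _ (FiniteModule.actr u (x ^+ i.+1))) f0y : y ^+ i.+1 \in E by rewrite groupX.
rewrite -[RHS]f0y ?/f; last first.
  by apply: contraNneq nty => yi1; have := gen_y _ co_i; rewrite yi1 cycle1 inE.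
rewrite prednK ?prime_gt0 //; apply: eq_bigr => j _.
rewrite -FiniteModule.actrM ?groupX ?NVE ?groupX //; congr (FiniteModule.actr _ _).
rewrite expgMn; last exact: commuteX.
by rewrite -!expgM mulnC.
Qed.

(** As [R] is abelian, ['N_G(R)] acts on it through a group of order prime to [p], and this order
    divides [p.-1 * p ^ m]. A prime factor would be smaller than [p], the least prime divisor of
    [#|G|]. So the action is trivial and [perfect_abelian_Sylow] applies. *)
Lemma perfect_cyclic_Sylow_pdiv (gT : finGroupType) (G R : {group gT}) :
  (pdiv #|G|).-Sylow(G) R -> G \subset G^`(1) -> cyclic R -> G :=: 1.
Proof.
move=> sylR perfG cycR; have [->//|ntG] := eqVneq (gval G) 1.
have p_pr : prime (pdiv #|G|) by rewrite pdiv_prime ?cardG_gt1.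
set p := pdiv #|G| in sylR p_pr.
have sRG := pHall_sub sylR; have pR := pHall_pgroup sylR.
have ntR : R :!=: 1.
  rewrite -rank_gt0 (rank_Sylow sylR) p_rank_gt0 mem_primes p_pr cardG_gt0.
  exact: pdiv_dvd.
case/eqP: (ntR); apply: (perfect_abelian_Sylow sylR perfG (cyclic_abelian cycR)).
pose f := conj_aut R; have nRN : 'N_G(R) \subset 'N(R) by apply: subsetIr.
have sylN : p.-Sylow('N_G(R)) R by apply: pHall_subl sylR; rewrite ?subsetIl // subsetI sRG normG.
suff: f @* 'N_G(R) = 1.
  by move/trivgP=> f1; rewrite -ker_conj_aut ker_trivg_morphim nRN.
apply/eqP; rewrite trivg_card1; apply: contraT => nt1.
have q_pr : prime (pdiv #|f @* 'N_G(R)|) by rewrite pdiv_prime // ltn_neqAle eq_sym nt1 cardG_gt0.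
set q := pdiv _ in q_pr; have q_dvd : q %| #|f @* 'N_G(R)| := pdiv_dvd _.
have := dvdn_trans q_dvd (cardSg (Aut_conj_aut R _)).
have [_ _ [m oR]] := pgroup_pdiv pR ntR.
rewrite card_Aut_cyclic // oR totient_pfactor // Euclid_dvdM //.
have q_dvdN : q %| #|'N_G(R) : R|.
  apply: dvdn_trans q_dvd _; rewrite card_morphim (setIidPr nRN) indexgS //=.
  by rewrite ker_conj_aut; apply: cyclic_abelian.
have p'q : q != p.
  have /and3P[_ _ p'N] := sylN.
  by apply: contraL q_dvdN => /eqP->; rewrite -p'natE.
case/orP; last by rewrite Euclid_dvdX // dvdn_prime2 // (negPf p'q).
move=> q_dvd_p1; have: q <= p.-1 by apply: dvdn_leq => //; rewrite -subn1 subn_gt0 prime_gt1.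
have: p <= q.
  apply: pdiv_min_dvd; first exact: prime_gt1.
  apply: dvdn_trans (dvdn_trans q_dvdN (dvdn_indexg _ _)) _.
  by apply: cardSg; apply: subsetIl.
by move=> le_pq /(leq_trans le_pq); rewrite leqNgt prednK ?prime_gt0 // leqnn.
Qed.

(** A [p']-element [h] normalizing [R] centralizes [c], which generates the only subgroup of order
    [p] of [R]. By coprime action [[~: R, <[h]>]] has no nontrivial fixed point, so it is trivial.
    Thus ['N_G(R)] centralizes [R], and [R] would be trivial. *)
Lemma perfect_central_Sylow (gT : finGroupType) (G R : {group gT}) c p :
    prime p -> p.-Sylow(G) R -> G \subset G^`(1) -> cyclic R ->
    c \in 'Z(G) -> #[c] = p ->
  false.
Proof.
move=> p_pr sylR perfG cycR /setIP[Gc cGc] oc.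
have sRG := pHall_sub sylR; have pR := pHall_pgroup sylR.
have abR := cyclic_abelian cycR.
have Rc : c \in R.
  have [u Gu Rcu] : exists2 u, u \in G & <[c]> \subset R :^ u.
    by apply: Sylow_subJ sylR _ _; rewrite ?cycle_subG // /pgroup -orderE oc pnat_id.
  have : c ^ u^-1 \in R by rewrite -mem_conjg -cycle_subG.
  by rewrite conjgE (centP cGc u^-1) ?groupV // mulKg.
have sylN : p.-Sylow('N_G(R)) R by apply: pHall_subl sylR; rewrite ?subsetIl // subsetI sRG normG.
suff R1 : R :=: 1 by move: Rc; rewrite R1 => /set1P c1; move: p_pr; rewrite -oc c1 order1.
apply: (perfect_abelian_Sylow sylR perfG abR).
apply/subsetP=> g Ng; have /setIP[Gg nRg] := Ng.
rewrite -(consttC p g) groupM //.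
  apply: (subsetP abR); rewrite (mem_normal_Hall sylN) ?p_elt_constt ?groupX //.
  by rewrite /normal subsetI sRG normG subsetIr.
set h := g.`_p^'; have nRh : h \in 'N(R) by rewrite groupX.
have Gh : h \in G by rewrite groupX.
have coRh : coprime #|R| #|<[h]>|.
  by apply: pnat_coprime pR _; rewrite -orderE; apply: p_elt_constt.
have := coprime_abel_cent_TI _ coRh abR; rewrite cycle_subG => /(_ nRh) TI.
suff Rh1 : [~: R, <[h]>] = 1.
  by rewrite -cycle_subG centsC; apply/commG1P.
apply/eqP; apply: contraT => ntRh.
have sRhR : [~: R, <[h]>] \subset R by rewrite commg_subl cycle_subG.
have [_ p_dvd _] := pgroup_pdiv (pgroupS sRhR pR) ntRh.
have [d Rd od] := Cauchy p_pr p_dvd.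
have /set1P c1 : c \in [1 gT]; last by move: p_pr; rewrite -oc c1 order1.
rewrite -TI inE; apply/andP; split; last first.
  by rewrite cent_cycle; apply/cent1P; rewrite /commute (centP cGc).
suff scRh : <[c]> \subset [~: R, <[h]>] by apply: (subsetP scRh); apply: cycle_id.
have sdRh : <[d]> \subset [~: R, <[h]>] by rewrite cycle_subG.
have /eqP -> : <[c]> == <[d]> :> {set gT}; last exact: sdRh.
rewrite (eq_subG_cyclic cycR) ?cycle_subG // ?(subsetP sRhR) //.
by apply/eqP; rewrite -[LHS]/#[c] -[RHS]/#[d] oc od.
Qed.

(** * Fusion in generalized quaternion Sylow subgroups *)

Lemma mem_cycle_order4 (gT : finGroupType) (x y : gT) :
  #[x] = 4 -> y \in <[x]> -> [\/ y = 1, y = x, y = x ^+ 2 | y = x^-1].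
Proof.
move=> ox /cyclePmin[i]; rewrite ox.
case: i => [|[|[|[|//]]]] _ ->; first by constructor 1.
- by constructor 2.
- by constructor 3.
by constructor 4; apply/esym/eqP; rewrite eq_invg_mul -expgS -ox expg_order.
Qed.

Lemma conjg_inverted (gT : groupType) (x y : gT) :
  x ^ y = x^-1 -> y ^ x = y * x ^+ 2.
Proof.
move=> xy; have xy' : x * y = y * x^-1 by rewrite conjgC xy.
have -> : y ^ x = x^-1 * (x * y * x) * x by rewrite xy' mulgKV conjgE mulgA.
by rewrite !mulgA mulVg mul1g -mulgA -expg2.
Qed.

(* On <s, t> = Q8 the element rho * sigma permutes s -> st -> t -> s. *)
Lemma quaternion_3cycle (gT : finGroupType) (s t rho sigma : gT) :
    s ^ t = s^-1 -> s ^+ 2 = t ^+ 2 -> t != 1 ->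
    rho ^+ 2 = s -> rho ^ t = rho^-1 -> t ^ sigma = t -> s ^ sigma = s * t ->
  3 %| #[rho * sigma].
Proof.
move=> st s2t2 nt1 rho2 rhot tsig ssig; set g := rho * sigma.
have srho : s ^ rho = s by rewrite -rho2 conjXg conjgE mulKg.
have st' : s * t = t * s^-1 by rewrite conjgC st.
have sts : s * t * s = t by rewrite st' mulgKV.
have tst : t * s * t = s by rewrite -mulgA st' mulgA -expg2 -s2t2 expg2 mulgK.
have trho : t ^ rho = t * s by rewrite conjg_inverted // rho2.
have sg : s ^ g = s * t by rewrite conjgM srho.
have tg : t ^ g = s by rewrite conjgM trho conjMg tsig ssig mulgA.
clearbody g.
have sg3 : s ^ (g ^+ 3) = s.
  by rewrite !expgS expg0 mulg1 2!conjgM sg (conjMg s t) sg tg sts.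
apply: contraT; rewrite -prime_coprime // coprime_sym => co.
have /cycleP[k gk] : g \in <[g ^+ 3]>.
  have : generator <[g]> (g ^+ 3) by rewrite generator_coprime.
  by move/eqP <-; apply: cycle_id.
have : s ^ g = s.
  rewrite gk; elim: k {gk} => [|k IH]; first by rewrite expg0 conjg1.
  by rewrite expgS conjgM sg3.
by move/eqP; rewrite sg -{2}[s]mulg1 (inj_eq (mulgI s)) (negPf nt1).
Qed.

(* By transfer to [S / <[x]>], some [t] outside the maximal cyclic subgroup [<[x]>] fuses
   to an element of [<[x]>]. If [S] is larger than Q8, two square roots of order 8 give a
   [quaternion_3cycle]; otherwise the odd part of a fusing element permutes the three cyclic
   subgroups of order 4 of [S] nontrivially. *)
Lemma quaternion_fusion (gT : finGroupType) (G S : {group gT}) n :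
    2.-Sylow(G) S -> n > 2 -> S \isog 'Q_(2 ^ n) -> G \subset G^`(1) ->
  3 %| #|G|.
Proof.
move=> sylS n_gt2 isoS perfG.
have [[x y0] genS _] := generators_quaternion n_gt2 isoS.
have [[_ o4 inv] _ [_ _ uniq2 _ _] _ _] := quaternion_structure n_gt2 genS isoS.
have [pS maxX nsXS defS nX] := extremal_generators_facts (isT : prime 2) genS.
have [oS Sx ox /setDP[Sy0 X'y0]] := genS.
have sSG := pHall_sub sylS; have [sXS nXS] := andP nsXS.
have index2 : #|S : <[x]>| = 2.
  by rewrite (p_maximal_index pS maxX).
have /exists_inP[t /setDP[St X't] /exists_inP[u Gu Xtu]] :
    [exists t in S :\: <[x]>, exists u in G, t ^ u \in <[x]>].
  (* Otherwise the quotient map onto [S / <[x]>] is constant on fusion classes, and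
     [perfect_transfer] forces [S] into [<[x]>]. *)
  apply: contraT; rewrite negb_exists_in => /forall_inP noF.
  have noFus t u : t \in S -> u \in G -> t ^ u \in S -> (t ^ u \in <[x]>) = (t \in <[x]>).
    have aux v w : v \in S -> w \in G -> v ^ w \in <[x]> -> v \in <[x]>.
      move=> Sv Gw Xvw; apply: contraT => X'v.
      have : v \in S :\: <[x]> by rewrite inE X'v.
      by move/noF; rewrite negb_exists_in => /forall_inP/(_ w Gw); rewrite Xvw.
    move=> St Gu Stu; apply/idP/idP => [|Xt]; first exact: aux.
    by apply: (aux _ u^-1); rewrite ?groupV // conjgK.
  pose alpha := restrm_morphism nXS (coset_morphism <[x]>).
  have imS : alpha @* S = S / <[x]> by rewrite morphim_restrm setIid.
  have : alpha @* S = 1.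
    apply: (perfect_transfer sylS perfG).
      rewrite imS; apply: cyclic_abelian; apply: prime_cyclic.
      by rewrite card_quotient // index2.
    move=> v w Sv Gw Svw; rewrite /alpha /= /restrm.
    have Nv := subsetP nXS v Sv; have Nvw := subsetP nXS _ Svw.
    have := noFus v w Sv Gw Svw; case: (boolP (v \in <[x]>)) => [Xv Xvw|X'v X'vw].
      by rewrite !coset_id.
    apply/rcoset_kercosetP => //.
    have -> : <[x]> :* v = S :\: <[x]> by apply: rcoset_index2 => //; rewrite inE X'v.
    by rewrite inE X'vw.
  move/eqP; rewrite imS -subG1 quotient_sub1 // => /subsetP/(_ y0 Sy0).
  by rewrite (negPf X'y0).
pose s := t ^ u; have ot : #[t] = 4 by rewrite o4 // inE X't.
have os : #[s] = 4 by rewrite orderJ.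
have Ss : s \in S by apply: (subsetP sXS).
have invX v c : c \in S -> c \notin <[x]> -> v \in <[x]> -> v ^ c = v^-1.
  by move=> Sc X'c Xv; apply: inv => //; rewrite inE X'c.
have sqS c : c \in S -> #[c] = 4 -> c ^+ 2 = s ^+ 2.
  have o2 (d : gT) : #[d] = 4 -> #[d ^+ 2] = 2 by move=> od; rewrite orderXdiv od.
  move=> Sc oc; have -> := uniq2 _ (groupX 2 Sc) (o2 _ oc).
  by have -> := uniq2 _ (groupX 2 Ss) (o2 _ os).
have cycX v : v \in <[x]> -> #[v] = 4 -> <[v]> = <[s]>.
  by move=> Xv ov; apply/eqP;
    rewrite (eq_subG_cyclic (cycle_cyclic x)) ?cycle_subG // -!orderE ov os.
have nsS : S \subset 'N(<[s]>).
  apply/subsetP=> c Sc.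
  have Nc v : s ^ c = v -> v \in <[s]> -> c \in 'N(<[s]>).
    by move=> sc sv; rewrite inE -cycleJ sc cycle_subG.
  have [Xc|X'c] := boolP (c \in <[x]>).
    have cxs : commute s c by apply: (centsP (cycle_abelian x)).
    by apply: Nc (cycle_id _); rewrite conjgE cxs mulKg.
  by apply: Nc (invX _ _ Sc X'c Xtu) _; rewrite groupV cycle_id.
have sXs : <[s]> \subset <[x]> by rewrite cycle_subG.
(* [<[s]>] is normal in [S], so [S] is Sylow in its normalizer. Sylow's theorem there corrects [u]
   so that the image of ['N_S(<[t]>)], which contains [s], lands in [S]. *)
have [w [Gw defs X'sw Ssw]] : exists w, [/\ w \in G, <[t ^ w]> = <[s]>,
  s ^ w \notin <[x]> & s ^ w \in S].
  have ts : t ^ s = t^-1.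
    rewrite conjg_inverted ?invX // -(sqS t) // -expgS.
    by apply/esym/eqP; rewrite eq_invg_mul -expgS -ot expg_order.
  pose Q := ('N_S(<[t]>))%G.
  have sylN : 2.-Sylow('N_G(<[s]>)) S by apply: pHall_subl sylS; rewrite ?subsetIl // subsetI sSG.
  have sQN : Q :^ u \subset 'N_G(<[s]>).
    by rewrite /s cycleJ normJ -[X in X :&: _](conjGid Gu) -conjIg conjSg setSI.
  have pQ : 2.-group (Q :^ u) by rewrite pgroupJ (pgroupS (subsetIl _ _) pS).
  have [v /setIP[Gv Nv] sQv] := Sylow_subJ sylN sQN pQ.
  have defs : <[t ^ (u * v^-1)]> = <[s]>.
    by rewrite conjgM cycleJ (normP (groupVr Nv)).
  exists (u * v^-1); split=> //; first by rewrite groupM ?groupV.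
    apply: contra X't => Xsw.
    have: <[s ^ (u * v^-1)]> = <[s]> by rewrite cycX ?orderJ.
    rewrite -defs; move: (s) (sXs) => c sXc.
    rewrite (cycleJ c) (cycleJ t) => /conjsg_inj defst.
    by have := cycle_id t; rewrite -defst; apply: (subsetP sXc).
  rewrite conjgM -mem_conjg; apply: (subsetP sQv); rewrite memJ_conjg inE Ss.
  by rewrite inE -cycleJ ts cycleV subxx andbT.
have [n3|n_neq3] := eqVneq n 3; last first.
  have n_gt3 : n > 3 by rewrite ltn_neqAle eq_sym n_neq3.
  have half v : v \in <[x]> -> #[v] = 4 -> exists2 rho, rho \in <[x]> & rho ^+ 2 = v.
    have [m oxm] : exists m, #[x] = (m * 2 * 4)%N.
      exists (2 ^ (n - 4))%N; rewrite ox; have -> : n.-1 = (n - 4).+3 by move: n_gt3; clear; lia.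
      by rewrite !expnS; move: (2 ^ (n - 4))%N => m; clear; lia.
    have m_gt0 : 0 < m * 2 by move: (order_gt0 x); rewrite oxm; case: (m).
    move=> Xv ov; have ox0 : #[x ^+ (m * 2)] = 4 by rewrite orderXdiv oxm ?mulKn // dvdn_mulr.
    have : v \in <[x ^+ (m * 2)]>.
      by rewrite (cycX _ _ ox0) ?mem_cycle // -(cycX v) ?cycle_id.
    case/cycleP=> k ->; exists (x ^+ (m * k)); first exact: mem_cycle.
    by rewrite -!expgM mulnAC.
  have [rho Xrho rho2] := half s Xtu os.
  have otw : #[t ^ w] = 4 by rewrite orderJ.
  have Xtw : t ^ w \in <[x]> by have := cycle_id (t ^ w); rewrite defs; apply/subsetP;
    rewrite cycle_subG.
  have [rho' Xrho' rho'2] := half _ Xtw otw.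
  (* [sigma] is a square root of [t], hence fixes [t]. As [s ^ w] inverts [rho'], [sigma] takes [s]
     to [s * t]. *)
  pose sigma := rho' ^ w^-1.
  have sigE v : v ^ sigma = ((v ^ w) ^ rho') ^ w^-1 by rewrite conjJg conjgK.
  have Gsig : rho * sigma \in G.
    by rewrite groupM ?groupJ ?groupV // (subsetP sSG) // (subsetP sXS).
  apply: dvdn_trans (order_dvdG Gsig); apply: (@quaternion_3cycle _ s t) => //.
  - exact: invX.
  - by rewrite (sqS t).
  - by apply: contraNneq X't => ->; apply: group1.
  - exact: invX.
  - by rewrite sigE -rho'2 conjXg [rho' ^ rho']conjgE mulKg rho'2 conjgK.
  - by rewrite sigE (conjg_inverted (invX _ _ Ssw X'sw Xrho')) conjMg rho'2 !conjgK.
have Xs : s \in <[x]> := Xtu; clearbody s.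
apply: contraT; rewrite -prime_coprime // => co3.
have X4 : #[x] = 4 by rewrite ox n3.
have defX : <[x]> = <[s]> by rewrite -(cycX x) ?cycle_id.
have splitS v : v \in S -> v \in <[s]> \/ v * t^-1 \in <[s]>.
  move=> Sv; have [|X'v] := boolP (v \in <[x]>); first by rewrite defX; left.
  right; rewrite -defX -mem_rcoset.
  by rewrite (rcoset_index2 sXS index2) inE ?X't ?X'v.
(* Here [S] is Q8, generated by [s] and [t], and [w] takes both into [S]. *)
have Nw : w \in 'N_G(S).
  rewrite inE Gw inE; apply/subsetP=> _ /imsetP[v Sv ->].
  have Sst c : c \in <[s]> -> c ^ w \in S.
    by case/cycleP=> k ->; rewrite conjXg groupX.
  have [/Sst//|/Sst] := splitS v Sv.
  rewrite conjMg groupMr // conjVg groupV.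
  by have := cycle_id (t ^ w); rewrite defs; apply: subsetP; rewrite cycle_subG.
have sylN : 2.-Sylow('N_G(S)) S by apply: pHall_subl sylS; rewrite ?subsetIl // subsetI sSG normG.
(* The 2-part of [w] lies in [S], which normalizes [<[t]>]; so the odd part still takes [<[t]>] to
   [<[s]>]. *)
set w' := w.`_2^'; have Nw' : <[w']> \subset 'N(S).
  by rewrite cycle_subG groupX //; case/setIP: Nw.
have co2 : coprime 2 #[w'] by apply: (@pnat_coprime 2) => //; apply: p_elt_constt.
have {}co3 : coprime 3 #[w'].
  apply: coprime_dvdr (order_dvdG _) co3; rewrite groupX //.
have sS2 : w.`_2 \in S.
  rewrite (mem_normal_Hall sylN) ?p_elt_constt ?groupX //.
  by rewrite /normal subsetI sSG normG subsetIr.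
have nt : S \subset 'N(<[t]>).
  apply: normal_norm; apply: index2_normal; rewrite ?cycle_subG //.
  by rewrite -divgS ?cycle_subG // -orderE ot oS n3.
have tw' : <[t]> :^ w' = <[s]>.
  by rewrite -defs cycleJ -[in RHS](consttC 2 w) conjsgM (normsP nt _ sS2).
have stinv : s^-1 * t = (s * t)^-1.
  rewrite [s * t]conjgC invX // invMg invgK; apply: (mulgI s).
  by rewrite mulKVg mulgA -expg2 -(sqS t) // expg2 mulgK.
have t3 : t ^+ 3 = t^-1 by apply/esym/eqP; rewrite eq_invg_mul -expgS -ot expg_order.
pose D := [set <[s]>; <[t]>; <[s * t]>].
have DP v : v \in S -> #[v] = 4 -> <[v]> \in D.
  move=> Sv ov; have [sv|] := splitS v Sv.
    by rewrite (cycX v) ?defX // !inE eqxx.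
  have eqv c : v * t^-1 = c -> v = c * t by move=> <-; rewrite mulgVK.
  case/(mem_cycle_order4 os) => /eqv ->; rewrite !inE ?mul1g ?eqxx ?orbT //.
    by rewrite -(sqS t) // -expgSr t3 cycleV eqxx orbT.
  by rewrite stinv cycleV eqxx !orbT.
(* The orbit has length at most 3, and its length divides [#[w']], which is prime to 2 and, by
   assumption, to 3. So it is a single subgroup, although it contains [<[t]>] and [<[s]>]. *)
pose O := orbit 'Js <[w']> <[t]>.
have sOD : O \subset D.
  apply/subsetP=> _ /orbitP[c wc <-]; rewrite /= -cycleJ DP ?orderJ //.
  by rewrite memJ_norm // (subsetP Nw').
have O1 : #|O| = 1%N.
  have := dvdn_orbit 'Js <[w']> <[t]>; rewrite -/O -orderE => dvdO.
  have := coprime_dvdr dvdO co2; have := coprime_dvdr dvdO co3.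
  have : #|O| <= 3.
    apply: leq_trans (subset_leq_card sOD) _.
    by apply: leq_trans (leq_card_setU _ _) _; rewrite cards1 cards2 addn1; case: (_ != _).
  have : 0 < #|O| by apply/card_gt0P; exists <[t]>; apply: orbit_refl.
  by case: #|O| => [|[|[|[|]]]].
have : <[s]> \in O by apply/orbitP; exists w'; rewrite ?cycle_id.
have /cards1P[A defO] : #|O| == 1%N by rewrite O1.
have : <[t]> \in O by apply: orbit_refl.
rewrite defO !inE => /eqP <- /eqP defst.
by case/negP: X't; rewrite defX defst cycle_id.
Qed.

(** * Solvability of Frobenius complements *)

(** For an involution [c], the element [v * v ^ c] is fixed by [c], hence trivial; so [c] inverts
    [V]. The quotient of two involutions then centralizes [V] and is trivial. *)
Lemma semiregular_involution (gT : finGroupType) (V C : {group gT}) s t :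
    abelian V -> V :!=: 1 -> C \subset 'N(V) -> semiregular V C ->
    s \in C -> t \in C -> #[s] = 2 -> #[t] = 2 -> s = t.
Proof.
move=> abV ntV nVC regVC Cs Ct os ot.
have inv c v : c \in C -> #[c] = 2 -> v \in V -> v ^ c = v^-1.
  move=> Cc oc Vv; have Vvc : v ^ c \in V by rewrite memJ_norm // (subsetP nVC).
  apply/eqP; rewrite eq_sym eq_invg_mul; apply/eqP/set1gP.
  rewrite -(regVC c); last by rewrite !inE Cc -order_gt1 oc.
  rewrite inE groupM //; apply/cent1P.
  have vcc : (v * v ^ c) ^ c = v * v ^ c.
    rewrite conjMg -conjgM -expg2 -oc expg_order conjg1.
    exact: (centsP abV).
  by rewrite /commute conjgC vcc.
apply/eqP; rewrite eq_mulVg1; apply: contraT => ntst.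
have [v Vv ntv] := trivgPn _ ntV.
have : v \in 'C_V[s^-1 * t].
  rewrite inE Vv; apply/cent1P.
  have vst : v ^ (s^-1 * t) = v.
    by rewrite conjgM !inv ?groupV ?inv ?orderV ?invgK.
  by rewrite /commute conjgC vst.
by rewrite regVC ?inE ?ntst ?groupM ?groupV // (negPf ntv).
Qed.

(** A nontrivial perfect subgroup [H] has cyclic Sylow subgroups at odd primes, by
    [semiregular_rank], but not at its least prime divisor, by [perfect_cyclic_Sylow_pdiv]. So that
    prime is 2, and a noncyclic 2-group with one involution is generalized quaternion. *)
Lemma semiregular_solvable (gT : finGroupType) (V C : {group gT}) :
    abelian V -> V :!=: 1 -> C \subset 'N(V) -> semiregular V C ->
    {in C &, forall c d, #[c] = 3 -> #[d] = 3 -> commute c d} ->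
  solvable C.
Proof.
move=> abV ntV nVC regVC comm3; apply/forall_inP=> H /subsetIP[sHC perfH].
have nVH := subset_trans sHC nVC.
have regVH : semiregular V H := semiregularS (subxx _) sHC regVC.
have rank1 r (R : {group gT}) : prime r -> R \subset H -> 'r_r(R) <= 1.
  move=> r_pr sRH; apply: leq_trans (semiregular_rank r_pr abV ntV nVH regVH).
  exact: p_rankS.
have cyc_odd r (R : {group gT}) : prime r -> odd r -> r.-group R -> R \subset H -> cyclic R.
  move=> r_pr odd_r rR sRH; rewrite (odd_pgroup_rank1_cyclic rR) ?rank1 //.
  by rewrite (card_pgroup rR) oddX odd_r orbT.
have [R sylR] := Sylow_exists (pdiv #|H|) H.
have sRH := pHall_sub sylR.
apply: contraT => ntH; have p_pr : prime (pdiv #|H|) by rewrite pdiv_prime ?cardG_gt1.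
have pR := pHall_pgroup sylR.
have [odd_p|] := boolP (odd (pdiv #|H|)).
  by case/eqP: ntH; apply: perfect_cyclic_Sylow_pdiv sylR perfH (cyc_odd _ _ p_pr odd_p pR sRH).
move=> even_p; have p2 : pdiv #|H| = 2 by case: (even_prime p_pr) even_p => // ->.
have ntR : R :!=: 1.
  rewrite -rank_gt0 (rank_Sylow sylR) p_rank_gt0 mem_primes p_pr cardG_gt0.
  exact: pdiv_dvd.
have [_ p_dvdR _] := pgroup_pdiv pR ntR.
have [z Rz oz] := Cauchy p_pr p_dvdR.
rewrite p2 in sylR pR oz.
have oOhm : #|'Ohm_1(R)| = 2.
  have -> : 'Ohm_1(R) = <[z]>; last by rewrite -orderE.
  have z2 : z ^+ 2 = 1 by rewrite -[in LHS]oz expg_order.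
  apply/eqP; rewrite eqEsubset cycle_subG (OhmE 1 pR) gen_subG; apply/andP; split; last first.
    by apply: mem_gen; rewrite inE Rz oz /=; apply/eqP.
  apply/subsetP=> t /LdivP[Rt t2]; have [->|nt1] := eqVneq t 1; first exact: group1.
  have ot : #[t] = 2 by apply: nt_prime_order.
  rewrite (semiregular_involution abV ntV nVH regVH (subsetP sRH _ Rt) (subsetP sRH _ Rz) ot oz).
  exact: cycle_id.
have : cyclic R || (2 == 2) && (extremal_class R == Quaternion) by apply/prime_Ohm1P.
case/orP=> [cycR|/andP[_ /eqP/quaternion_classP[n n_gt2 isoR]]].
  by case/eqP: ntH; apply: perfect_cyclic_Sylow_pdiv cycR; rewrite // p2.
have [c Hc oc] := Cauchy (isT : prime 3) (quaternion_fusion sylR n_gt2 isoR perfH).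
have [R3 sylR3] := Sylow_exists 3 H.
have sR3H := pHall_sub sylR3; have pR3 := pHall_pgroup sylR3.
have cycR3 := cyc_odd _ _ (isT : prime 3) isT pR3 sR3H.
suff cH : H \subset 'C[c].
  have Zc : c \in 'Z(H) by rewrite inE Hc -sub_cent1.
  by have := perfect_central_Sylow (isT : prime 3) sylR3 perfH cycR3 Zc oc.
(* [c] and its conjugate commute, so they generate a 3-group, which is cyclic and has a single
   subgroup of order 3. *)
have nc : H \subset 'N(<[c]>).
  apply/subsetP=> g Hg.
  have oE d : #[d] = 3 -> 3.-group <[d]> by move=> od; rewrite /pgroup -orderE od.
  have ocg : #[c ^ g] = 3 by rewrite orderJ.
  have Hcg : c ^ g \in H by rewrite groupJ.
  have ccg : commute c (c ^ g) by apply: comm3; rewrite ?(subsetP sHC).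
  pose E := (<[c]> <*> <[c ^ g]>)%G.
  have cE : cyclic E.
    apply: (cyc_odd 3) => //; last by rewrite join_subG !cycle_subG Hc.
    by rewrite /= cent_joinEr ?pgroupM ?oE // cent_cycle cycle_subG; apply/cent1P.
  rewrite inE -cycleJ; have /eqP -> // : <[c ^ g]> == <[c]> :> {set gT}.
  rewrite (eq_subG_cyclic cE) ?joing_subl ?joing_subr //.
  by apply/eqP; rewrite -[LHS]/#[c ^ g] -[RHS]/#[c] oc ocg.
(* The perfect group [H] acts on [<[c]>] through an abelian automorphism group, hence trivially. *)
rewrite -cent_cycle -ker_conj_aut ker_trivg_morphim nc /=.
apply: subset_trans (morphimS _ perfH) _.
rewrite -derg1 morphim_der // der1_min ?norms1 // quotient_abelian //.
by apply: abelianS (Aut_conj_aut _ _) _; apply/Aut_cyclic_abelian/cycle_cyclic.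
Qed.

(** * Finite subgroups of abstract groups *)

From mathcomp Require Import finmap boolp classical_sets functions cardinality.

Local Open Scope classical_set_scope.
Local Open Scope group_scope.

Lemma finite_set_finType (T : Type) (A : set T) :
  finite_set A -> exists (fT : finType) (f : fT -> T),
    injective f /\ forall x, A x <-> exists i, f i = x.
Proof.
move=> finA; pose A' : set {classic T} := A.
exists (fset_set A' : finType), (fun i => val i : {classic T}); split; first exact: val_inj.
move=> x; split=> [Ax|[i <-]].
  have Ax' : (x : {classic T}) \in fset_set A' by rewrite in_fset_set // inE.
  by exists [` Ax']%fset.
by have := valP i; rewrite in_fset_set // inE.
Qed.

Section FinGroupOfAxioms.
Variables (T : finType) (mul : T -> T -> T) (one : T) (inv : T -> T).
Hypotheses (mulA : associative mul) (mul1 : left_id one mul).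
Hypothesis mulV : left_inverse one inv mul.

(* The vacuous [let]s make the axioms parameters of the type, as its instances require. *)
Definition group_of_axioms : Type :=
  let _ := mulA in let _ := mul1 in let _ := mulV in T.
HB.instance Definition _ := Finite.copy group_of_axioms T.
HB.instance Definition _ := Finite_isGroup.Build group_of_axioms mulA mul1 mulV.

End FinGroupOfAxioms.

Lemma finite_subgroup_finGroup (gT : groupType) (H : set gT) :
    is_subgroup H -> finite_set H ->
  exists (hT : finGroupType) (f : hT -> gT),
    [/\ injective f, {morph f : x y / x * y} & forall g, H g <-> exists x, f x = g].
Proof.
move=> [H1 HM HV] finH.
have [T [f [f_inj fP]]] := finite_set_finType finH.
have Hf x : H (f x) by apply/fP; exists x.
have lift g : H g -> {x | f x = g} by move=> Hg; apply/cid/fP.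
pose mul x y := sval (lift _ (HM _ _ (Hf x) (Hf y))).
pose one := sval (lift _ H1).
pose inv x := sval (lift _ (HV _ (Hf x))).
have fM x y : f (mul x y) = f x * f y by apply: (svalP (lift _ _)).
have f1 : f one = 1 by apply: (svalP (lift _ _)).
have fV x : f (inv x) = (f x)^-1 by apply: (svalP (lift _ _)).
have mulA : associative mul by move=> x y z; apply: f_inj; rewrite !fM mulgA.
have mul1 : left_id one mul by move=> x; apply: f_inj; rewrite fM f1 mul1g.
have mulV : left_inverse one inv mul by move=> x; apply: f_inj; rewrite fM f1 fV mulVg.
by exists (group_of_axioms mulA mul1 mulV), f.
Qed.

(** By induction, each term of the abstract derived series of [range f] lies in the image of the
    corresponding term in [hT]. *)
Lemma solvable_is_solvable (hT : finGroupType) (gT : groupType) (f : hT -> gT) :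
    {morph f : x y / x * y} -> solvable [set: hT]%SET -> is_solvable (range f).
Proof.
move=> fM solT.
have f1 : f 1 = 1 by apply: (mulgI (f 1)); rewrite -fM !mulg1.
have fV x : f x^-1 = (f x)^-1 by apply: (mulgI (f x)); rewrite -fM !mulgV.
have sub n : is_subgroup (iter n (@derived gT) (range f)) /\
    iter n (@derived gT) (range f) `<=` f @` [set` ([set: hT]%SET^`(n))%g].
  elim: n => [|n [sgn sn]].
    split; last by rewrite derg0 => _ [x _ <-]; exists x; rewrite /= ?inE.
    split; first by exists 1.
      by move=> _ _ [x _ <-] [y _ <-]; exists (x * y).
    by move=> _ [x _ <-]; exists x^-1.
  split.
    split=> [H [[]]//|x y Hx Hy H sH|x Hx H sH].
      by case: (sH) => -[_ + _] _; apply; [apply: Hx|apply: Hy].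
    by case: (sH) => -[_ _ +] _; apply; apply: Hx.
  apply: smallest_sub.
    split; first by exists 1; rewrite //= group1.
      by move=> _ _ [x /= Hx <-] [y /= Hy <-]; exists (x * y); rewrite //= groupM.
    by move=> _ [x /= Hx <-]; exists x^-1; rewrite //= groupV.
  move=> _ [[x y] [/= /sn[u Hu <-] /sn[v Hv <-]] <-].
  exists [~ u, v]; last by rewrite /commg /conjg !fM !fV.
  by rewrite /= dergSn mem_commg.
have /derivedP[n Gn1] := solT.
exists n; have [[Hn1 _ _] sn] := sub n; apply/seteqP; split=> [g /sn[x /=]|_ -> //].
by move=> Gx <-; have /set1gP -> : x \in [1 hT]%g by rewrite -Gn1.
Qed.

(** * Sharply triply transitive groups *)

Lemma involutionP (gT : groupType) (g : gT) :
  involution g <-> g * g = 1 /\ g <> 1.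
Proof.
split=> [[_ g2 /(_ 1%N isT)]|[g2 g1]]; first by rewrite expg1 expg2 in g2 *.
by split=> // -[|[|]] // _; rewrite expg1.
Qed.

Lemma card_fibers_le (A B : finType) (g : A -> B) m :
  (forall y, #|[set x | g x == y]%SET| <= m) -> #|A| <= #|B| * m.
Proof.
move=> gm; rewrite -sum1_card (partition_big g predT) //= -sum_nat_const.
apply: leq_sum => y _; apply: leq_trans (gm y); rewrite -sum1_card.
by apply: eq_leq; apply: eq_bigl => x; rewrite inE.
Qed.

Section Sym.
Variable X : Type.
Implicit Types (s t : sym X) (x : X).

Lemma symM s t x : (s * t) x = t (s x). Proof. by []. Qed.
Lemma symK s x : s^-1 (s x) = x. Proof. exact: sym_funK. Qed.
Lemma symVK s x : s (s^-1 x) = x. Proof. exact: sym_invK. Qed.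
Lemma symJ s t x : (s ^ t) (t x) = t (s x).
Proof. by rewrite conjgE !symM symK. Qed.

Lemma sym_inj s x y : s x = s y -> x = y.
Proof. exact: (can_inj (@sym_funK X s)). Qed.

Lemma symV_fix s x : s x = x -> s^-1 x = x.
Proof. by move=> {1}<-; rewrite symK. Qed.

Lemma involution_swap s x : s * s = 1 -> s (s x) = x.
Proof. by move=> s2; rewrite -symM s2. Qed.

End Sym.

Section SharplyTriplyTransitive.
Variables (X : Type) (G : set (sym X)).
Hypothesis G3 : sharply_triply_transitive G.

Implicit Types (x y w : X) (g h s t k : sym X).

Lemma s3_group : is_subgroup G. Proof. by case: G3. Qed.
Let sG := s3_group.

Lemma s3M g h : G g -> G h -> G (g * h). Proof. by case: sG => _ + _; apply. Qed.
Lemma s3V g : G g -> G g^-1. Proof. by case: sG => _ _; apply. Qed.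
Lemma s3J g h : G g -> G h -> G (g ^ h).
Proof. by move=> Gg Gh; apply: s3M; [apply: s3V|apply: s3M]. Qed.

Lemma s3_eq g h x y w : x <> y -> x <> w -> y <> w -> G g -> G h ->
  g x = h x -> g y = h y -> g w = h w -> g = h.
Proof.
move=> xy xw yw Gg Gh ex ey ew; case: G3 => _ _ /(_ x y w (h x) (h y) (h w) xy xw yw).
move=> /(_ (xy \o @sym_inj _ h _ _) (xw \o @sym_inj _ h _ _) (yw \o @sym_inj _ h _ _)).
case=> k [_ uniq]; have <- : k = g by apply: uniq.
by apply: uniq.
Qed.

Lemma s3_fix g x y w : x <> y -> x <> w -> y <> w -> G g ->
  g x = x -> g y = y -> g w = w -> g = 1.
Proof. by move=> xy xw yw Gg ex ey ew; apply: (s3_eq xy xw yw) => //; case: sG. Qed.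

Lemma s3_ex x y w (x' y' w' : X) : x <> y -> x <> w -> y <> w ->
    x' <> y' -> x' <> w' -> y' <> w' ->
  exists g, [/\ G g, g x = x', g y = y' & g w = w'].
Proof.
move=> xy xw yw xy' xw' yw'; case: G3 => _ _ /(_ x y w x' y' w' xy xw yw xy' xw' yw').
by case=> g [[Gg [ex ey ew]] _]; exists g.
Qed.

Lemma s3_third x y : exists w, w <> x /\ w <> y.
Proof.
case: G3 => _ [c [d [e [cd ce de]]]] _.
have [cx|cx] := pselect (c = x); last have [cy|cy] := pselect (c = y); last by exists c.
  have [dy|dy] := pselect (d = y); first by exists e; split=> ?; subst.
  by exists d; split=> ?; subst.
have [dx|dx] := pselect (d = x); first by exists e; split=> ?; subst.
by exists d; split=> ?; subst.
Qed.

Lemma s3_ex2 x y (x' y' : X) : x <> y -> x' <> y' -> exists g, [/\ G g, g x = x' & g y = y'].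
Proof.
move=> xy xy'; have [w [wx wy]] := s3_third x y; have [w' [wx' wy']] := s3_third x' y'.
have [|||||| g [Gg ex ey _]] := @s3_ex x y w x' y' w' => //; try exact: nesym.
by exists g.
Qed.

Lemma s3_swap x y w : x <> y -> x <> w -> y <> w ->
  exists s, [/\ G s, s * s = 1, s x = y, s y = x & s w = w].
Proof.
move=> xy xw yw; have [||||||s [Gs sx sy sw]] := @s3_ex x y w y x w => //; first exact: nesym.
exists s; split=> //; apply: (s3_fix xy xw yw); first exact: s3M.
- by rewrite symM sx.
- by rewrite symM sy.
by rewrite symM !sw.
Qed.

(** * The regular abelian normal subgroup and the involutions of a point stabilizer *)

Section RootGroup.
Variables (a b : X) (N : set (sym X)) (z : sym X) (p : nat).
Hypotheses (ba : b <> a) (nN : is_normal N (stabilizer G a)) (abN : is_abelian N).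
Hypothesis regN : is_regular N [set~ a].
Hypotheses (Gz : G z) (za : z a = a) (zb : z b = b) (zz : z * z = 1) (z1 : z <> 1).
Hypothesis p_odd : odd p.
Hypothesis charp : forall s t, G s -> s a = a -> s * s = 1 -> s <> 1 ->
  G t -> t a = a -> t * t = 1 -> t <> 1 -> s <> t -> (s * t) ^+ p = 1.
Implicit Types (n m : sym X) (c d : X).

Lemma rg1 : N 1. Proof. by case: nN => -[]. Qed.
Lemma rgM n m : N n -> N m -> N (n * m). Proof. by case: nN => -[_ + _] _ _; apply. Qed.
Lemma rgV n : N n -> N n^-1. Proof. by case: nN => -[_ _ +] _ _; apply. Qed.
Lemma rgX n j : N n -> N (n ^+ j).
Proof. by move=> Nn; elim: j => [|j IH]; rewrite ?expg0 ?expgS; [exact: rg1|exact: rgM]. Qed.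
Lemma rgJ n g : N n -> G g -> g a = a -> N (n ^ g).
Proof. by move=> Nn Gg ga; case: nN => _ _; apply. Qed.
Lemma rg_sub n : N n -> G n. Proof. by case: nN => _ sN _ /sN[]. Qed.
Lemma rg_a n : N n -> n a = a. Proof. by case: nN => _ sN _ /sN[]. Qed.

Lemma rg_moves n c : N n -> c <> a -> n c <> a.
Proof. by move=> Nn ca nca; apply: ca; apply: (@sym_inj _ n); rewrite nca rg_a. Qed.

Lemma rg_eq n m c : N n -> N m -> c <> a -> n c = m c -> n = m.
Proof.
move=> Nn Nm ca e; have [k [_ uniq]] := regN ca (rg_moves Nm ca).
by have <- : k = n; apply: uniq.
Qed.

Lemma rg_free n c : N n -> c <> a -> n c = c -> n = 1.
Proof. by move=> Nn ca nc; apply: (@rg_eq n 1 c) => //; apply: rg1. Qed.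

Lemma rg_trans c d : c <> a -> d <> a -> exists n, N n /\ n c = d.
Proof. by move=> ca da; have [n [? _]] := regN ca da; exists n. Qed.

(** [k] also fixes [n c], hence three points unless [n = 1]. *)
Lemma rg_cent k c n : G k -> k a = a -> k c = c -> c <> a -> k <> 1 -> N n ->
  n ^ k = n -> n = 1.
Proof.
move=> Gk ka kc ca k1 Nn nk; apply: contrapT => n1; apply: k1.
apply: (@s3_fix k a c (n c)) => //.
- exact: nesym.
- by move=> /esym; apply: rg_moves.
- by move=> /esym/(rg_free Nn ca).
by rewrite -symJ nk kc.
Qed.

Lemma rg_inv s c n : G s -> s a = a -> s c = c -> c <> a -> s * s = 1 -> s <> 1 ->
  N n -> n ^ s = n^-1.
Proof.
move=> Gs sa sc ca ss s1 Nn; have Nns := rgJ Nn Gs sa.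
have nns : n * n ^ s = 1.
  apply: (rg_cent Gs sa sc ca s1); first exact: rgM.
  by rewrite conjMg -conjgM ss conjg1 abN.
by apply: (mulgI n); rewrite nns mulgV.
Qed.

(** Both involutions invert [N], so their product centralizes it and [rg_cent] applies. *)
Lemma rg_involution_uniq s s' c : G s -> s a = a -> s c = c -> s * s = 1 -> s <> 1 ->
  G s' -> s' a = a -> s' c = c -> s' * s' = 1 -> s' <> 1 -> c <> a -> s = s'.
Proof.
move=> Gs sa sc ss s1 Gs' sa' sc' ss' s1' ca.
have [d [da dc]] := s3_third a c; have [n [Nn nc]] := rg_trans ca da.
have [ss1|ss1] := pselect (s * s' = 1).
  by apply: (mulIg s'); rewrite ss1 ss'.
have n1 : n = 1.
  apply: (@rg_cent (s * s') c) => //; first exact: s3M.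
  - by rewrite symM sa.
  - by rewrite symM sc.
  rewrite conjgM (rg_inv Gs sa sc) // (rg_inv Gs' sa' sc') ?invgK //; exact: rgV.
by case: dc; rewrite -nc n1.
Qed.

Lemma rg_zJ n : N n -> n ^ z = n^-1. Proof. exact: (@rg_inv z b). Qed.

Lemma rg_Jz n : N n -> z ^ n = z * (n * n).
Proof.
by move=> Nn; rewrite conjgE mulgA (conjgC n^-1) conjVg rg_zJ // invgK mulgA.
Qed.

Lemma rg_sqr1 n : N n -> n * n = 1 -> n = 1.
Proof.
move=> Nn nn; apply: (rg_cent Gz za zb ba z1 Nn); rewrite rg_zJ //.
by apply: (mulgI n); rewrite mulgV nn.
Qed.

(** The product of the involutions [z] and [z ^ n] is [n * n], whose [p]-th power is trivial by
    [charp]; and [N] contains no involution. *)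
Lemma rg_exp n : N n -> n ^+ p = 1.
Proof.
move=> Nn; have [->|n1] := pselect (n = 1); first by rewrite expg1n.
have zn1 : z <> z ^ n.
  rewrite rg_Jz // => e; apply: n1; apply: rg_sqr1 => //.
  by apply: (mulgI z); rewrite -e mulg1.
have znzn : z ^ n * z ^ n = 1 by rewrite -conjMg zz conj1g.
apply: rg_sqr1; first exact: rgX.
have znn1 : z ^ n <> 1 by move/eqP; rewrite conjg_eq1 => /eqP.
have zna : (z ^ n) a = a by rewrite -{1}(rg_a Nn) symJ za rg_a.
have := charp Gz za zz z1 (s3J Gz (rg_sub Nn)) zna znzn znn1 zn1.
rewrite rg_Jz // mulgA zz mul1g => <-.
by rewrite expgMn.
Qed.

(** The square root in [N]: the exponent is [(p + 1) / 2]. *)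
Definition rg_half n := n ^+ p./2.+1.

Lemma rg_halfE n : N n -> rg_half n * rg_half n = n.
Proof.
move=> Nn; rewrite /rg_half -expgnDr.
have -> : (p./2.+1 + p./2.+1 = p.+1)%N.
  by rewrite addSn addnS addnn -{2}(odd_double_half p) p_odd.
by rewrite expgS rg_exp // mulg1.
Qed.

Lemma rg_half_rg n : N n -> N (rg_half n). Proof. exact: rgX. Qed.

(** If [n] in [N] takes [b] to [i b], then [i * n^-1] fixes [a] and [b] and its square lies in [N],
    so it is an involution and equals [z]. Thus [i = z * n], the conjugate of [z] by the square root
    of [n]. *)
Lemma rg_involution i : G i -> i a = a -> i * i = 1 -> i <> 1 ->
  N (z * i) /\ i = z ^ rg_half (z * i).
Proof.
move=> Gi ia ii i1.
have ib : i b <> a by move=> /(congr1 i); rewrite involution_swap // ia.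
have [n [Nn nb]] := rg_trans ba ib.
pose k := i * n^-1.
have Gk : G k by apply: s3M => //; apply/rg_sub/rgV.
have ka : k a = a by rewrite symM ia symV_fix ?rg_a.
have kb : k b = b by rewrite symM -nb symK.
have Nkk : N (k * k).
  have -> : k * k = ((n^-1) ^ i) * n^-1.
    have iV : i^-1 = i by apply: (mulgI i); rewrite mulgV.
    by rewrite conjgE iV /k !mulgA.
  by apply: rgM; [apply: rgJ => //|]; apply: rgV.
have kk : k * k = 1 by apply: (rg_free Nkk ba); rewrite symM !kb.
have iE : i = k * n by rewrite /k mulgVK.
have k1 : k <> 1.
  move=> k1; have i_n : i = n by rewrite iE k1 mul1g.
  by apply: i1; rewrite i_n; apply: rg_sqr1 => //; rewrite -i_n.
have kz : k = z by apply: (@rg_involution_uniq k z b).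
have -> : z * i = n by rewrite iE kz mulgA zz mul1g.
by split=> //; rewrite rg_Jz ?rg_halfE -?kz //; apply: rg_half_rg.
Qed.

(** * Elements of order 3 and solvable finite subgroups *)

Lemma rg_zE n : N n -> z (n b) = n^-1 b.
Proof. by move=> Nn; rewrite -symJ zb rg_zJ. Qed.

Lemma rg_order3_inv t e k : e <> a -> e <> b ->
    G t -> t * t = 1 -> t a = b -> t b = a -> t e = e ->
    G k -> k a = a -> k b = b -> k ^+ 3 = 1 ->
  k ^ t = k^-1.
Proof.
move=> ea eb Gt tt ta tb te Gk ka kb k3.
have [->|k1] := pselect (k = 1); first by rewrite conj1g invg1.
have [n [Nn nb]] := rg_trans ba ea.
have ze : z e = n^-1 b by rewrite -nb rg_zE.
have [u [Gu ua ub ue uE]] : exists u : sym X,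
    [/\ G u, u a = a, u b = e, u e = b & forall x, u x = n (z x)].
  exists (z * n); split=> //; first by apply: s3M => //; apply: rg_sub.
  - by rewrite symM za rg_a.
  - by rewrite symM zb.
  - by rewrite symM ze symVK.
(* On {a, b, e} both sides are the transposition of [a] and [e]. *)
have tut x : t (u (t x)) = u (t (u x)).
  suff E : t * u * t = u * t * u by apply: (congr1 (fun s : sym X => s x) E).
  apply: (@s3_eq (t * u * t) _ a b e).
  - exact: nesym.
  - exact: nesym.
  - exact: nesym.
  - by do !apply: s3M => //.
  - by do !apply: s3M => //.
  - by rewrite !symM ta ub te ua ta.
  - by rewrite !symM tb ua ta ub te ue.
  - by rewrite !symM te ue tb ua.
have zt : z ^ t = z.
  apply: (@rg_involution_uniq (z ^ t) z b) => //.
  - exact: s3J.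
  - by rewrite -{1}tb symJ zb tb.
  - by rewrite -{1}ta symJ za ta.
  - by rewrite -conjMg zz conj1g.
  by move/eqP; rewrite conjg_eq1 => /eqP.
have tze : t (z e) = z e by rewrite -symJ zt te.
(* [n * n ^ v * (n ^ v) ^ v] is fixed by [v], hence trivial; evaluated at [b], this relation is the
   claim. *)
have key v : G v -> v a = a -> v b = b -> v ^+ 3 = 1 -> v <> 1 -> u (v (z e)) = v (v (z e)).
  move=> Gv va vb v3 v1.
  have Nv i : N i -> N (i ^ v) by move=> Ni; apply: rgJ.
  have vi (i : sym X) : v (i b) = (i ^ v) b by rewrite -{2}vb symJ.
  have Nn1 := Nv _ Nn; have Nn2 := Nv _ Nn1.
  have s0 : n * n ^ v * (n ^ v) ^ v = 1.
    apply: (rg_cent Gv va vb ba v1); first exact: (rgM (rgM Nn Nn1) Nn2).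
    rewrite (conjMg (n * n ^ v)) (conjMg n) -[((n ^ v) ^ v) ^ v]conjgM -[(n ^ v) ^ (v * v)]conjgM.
    have -> : v * (v * v) = 1 by rewrite -v3 !expgS expg0 mulg1.
    by rewrite conjg1 -(abN Nn (rgM Nn1 Nn2)) mulgA.
  rewrite ze !vi uE rg_zE; last by apply: Nv; apply: rgV.
  rewrite conjVg invgK -symM; apply: (congr1 (fun s : sym X => s b)).
  rewrite conjVg; apply: (mulIg ((n ^ v) ^ v)).
  by rewrite mulVg (abN (Nv _ Nn) Nn).
have tk x : t (k x) = (k ^ t) (t x) by rewrite symJ.
set k' := k ^ t in tk *.
have Gk' : G k' by apply: s3J.
have k'a : k' a = a by rewrite -{1}tb -tk kb tb.
have k'b : k' b = b by rewrite -{1}ta -tk ka ta.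
have k'3 : k' ^+ 3 = 1 by rewrite -conjXg k3 conj1g.
have k'1 : k' <> 1 by move/eqP; rewrite conjg_eq1 => /eqP.
have tk' x : t (k' x) = k (t x) by rewrite -{1}(involution_swap x tt) -tk involution_swap.
have cube s : s ^+ 3 = 1 -> s * (s * s) = 1 by move=> <-; rewrite !expgS expg0 mulg1.
(* Through [key], the relation [tut] at [k (z e)] becomes [k (k (z e)) = k' (z e)], so [k * k] and
   [k'] agree at three points. *)
have := tut (k (z e)); rewrite (key k) // !tk tze (key k') // !tk' tze.
have k2 : k' * k' <> 1.
  by move=> k2; apply: k'1; rewrite -[k']mulg1 -k2 cube.
have <- : (k' * k') (z e) = k' (k' (z e)) by [].
have k23 : (k' * k') ^+ 3 = 1 by rewrite expgMn // k'3 mulg1.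
rewrite (key (k' * k')) //; last first.
- by rewrite symM !k'b.
- by rewrite symM !k'a.
- exact: s3M.
have k4 : k' * k' * (k' * k') = k' by rewrite -mulgA cube // mulg1.
rewrite -[(k' * k') ((k' * k') _)]symM k4 -[k (k _)]symM => kk'.
have <- : k * k = k'.
  apply: (@s3_eq (k * k) k' a b (z e)) => //.
  - exact: nesym.
  - by move=> aze; apply: ea; apply: (@sym_inj _ z); rewrite -aze za.
  - by move=> bze; apply: eb; apply: (@sym_inj _ z); rewrite -bze zb.
  - exact: s3M.
  - by rewrite symM !ka k'a.
  - by rewrite symM !kb k'b.
by apply: (mulgI k); rewrite cube // mulgV.
Qed.

(** A suitable [t] inverts [k], [l] and [k ^ l], so [l] and [l^-1] conjugate [k] alike. Hence
    [l * l] centralizes [k], and so does [l], the square of [l * l]. *)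
Lemma rg_order3_commute k l : G k -> k a = a -> k b = b -> k ^+ 3 = 1 ->
  G l -> l a = a -> l b = b -> l ^+ 3 = 1 -> commute k l.
Proof.
move=> Gk ka kb k3 Gl la lb l3; have [e [ea eb]] := s3_third a b.
have [|||t [Gt tt ta tb te]] := @s3_swap a b e; try exact: nesym.
have inv := @rg_order3_inv t e _ ea eb Gt tt ta tb te.
have := inv (k ^ l); rewrite conjJg !inv //.
move=> /(_ (s3J Gk Gl)).
have -> : (k ^ l) a = a by rewrite -{1}la symJ ka la.
have -> : (k ^ l) b = b by rewrite -{1}lb symJ kb lb.
rewrite -conjXg k3 conj1g => /(_ erefl erefl erefl).
rewrite conjVg => /invg_inj /(congr1 (fun s => s ^ l)); rewrite conjgKV => kll.
have l4 : l = (l * l) * (l * l).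
  by rewrite -mulgA; have -> : l * (l * l) = 1; rewrite ?mulg1 // -l3 !expgS expg0 mulg1.
have : k ^ l = k by rewrite l4 !conjgM -kll -kll.
by move=> kl; rewrite /commute conjgC kl.
Qed.

Lemma rg_cent_z g : G g -> g a = a -> z ^ g = z -> g b = b.
Proof.
move=> Gg ga zg; apply: contrapT => gb; apply: z1.
apply: (@s3_fix z a b (g b)) => //.
- exact: nesym.
- by move=> /esym agb; apply: ba; apply: (@sym_inj _ g); rewrite agb ga.
- exact: nesym.
by rewrite -{1}zg symJ zb.
Qed.

(* [m] is the square root in [N] of [z * z ^ h], so that [z ^ h = z ^ m]. *)
Lemma rg_split (H : set (sym X)) h : is_subgroup H -> H `<=` G -> H z -> H h -> h a = a ->
  exists m, [/\ N m, H m & (h * m^-1) b = b].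
Proof.
move=> [H1 HM HV] sHG Hz Hh ha; have Gh := sHG _ Hh.
have zha : (z ^ h) a = a by rewrite -{1}ha symJ za ha.
have [||Nn zh] := rg_involution (s3J Gz Gh) zha; first by rewrite -conjMg zz conj1g.
  by move/eqP; rewrite conjg_eq1 => /eqP.
exists (rg_half (z * z ^ h)); split; first exact: rg_half_rg.
  have HX s j : H s -> H (s ^+ j).
    by move=> Hs; elim: j => [|j IH]; rewrite ?expg0 ?expgS //; apply: HM.
  by apply: HX; apply: (HM) => //; rewrite conjgE; apply: (HM); [exact: HV|exact: HM].
apply: rg_cent_z; last by rewrite conjgM {1}zh conjgK.
  by apply: s3M => //; apply: s3V; apply: rg_sub; apply: rg_half_rg.
by rewrite symM ha symV_fix // rg_a //; apply: rg_half_rg.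
Qed.

(** By [rg_split], [H] is the product of the abelian normal subgroup [N :&: H] and the stabilizer of
    [b]. The latter acts semiregularly on the former by [rg_cent], and [semiregular_solvable]
    applies by [rg_order3_commute]. *)
Lemma rg_solvable (H : set (sym X)) n : is_subgroup H -> H `<=` G -> finite_set H ->
  (forall h, H h -> h a = a) -> H z -> H n -> N n -> n <> 1 -> is_solvable H.
Proof.
move=> sgH sHG finH Ha Hz Hn Nn n1.
have [hT [f [f_inj fM fP]]] := finite_subgroup_finGroup sgH finH.
have Hf u : H (f u) by apply/fP; exists u.
have f1 : f 1 = 1 by apply: (mulgI (f 1)); rewrite -fM !mulg1.
have fV u : f u^-1 = (f u)^-1 by apply: (mulgI (f u)); rewrite -fM !mulgV.
have fJ u v : f (u ^ v) = f u ^ f v by rewrite !conjgE !fM fV.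
have -> : H = range f.
  by apply/seteqP; split=> [g /fP[u <-]|_ [u _ <-]]; [exists u|apply: Hf].
apply: (solvable_is_solvable fM).
pose V0 := [set u | `[< N (f u) >]]%SET.
pose C0 := [set u | `[< f u b = b >]]%SET.
have gV : group_set V0.
  apply/group_setP; split=> [|u v]; rewrite !inE ?f1; first exact: rg1.
  by have -> : f (u * v) = f u * f v := fM u v; apply: rgM.
have gC : group_set C0.
  apply/group_setP; split=> [|u v]; rewrite !inE ?f1 //.
  by have -> : f (u * v) = f u * f v := fM u v; rewrite symM => -> ->.
pose V := Group gV; pose C := Group gC.
have VP u : reflect (N (f u)) (u \in V) by rewrite inE; apply: asboolP.
have CP u : reflect (f u b = b) (u \in C) by rewrite inE; apply: asboolP.
have nV : [set: hT]%SET \subset 'N(V).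
  apply/fintype.subsetP=> u _; rewrite inE; apply/fintype.subsetP=> _ /imsetP[v /VP Ny ->].
  by apply/VP; rewrite fJ; apply: rgJ => //; [apply: sHG|apply: Ha].
have abV : abelian V.
  by apply/centsP=> u /VP Nx v /VP Ny; apply: (f_inj); rewrite !fM abN.
have ntV : V :!=: [1 hT]%g.
  have [u xn] := (fP n).1 Hn; apply/trivgPn; exists u; first by apply/VP; rewrite xn.
  by apply/eqP => x1; apply: n1; rewrite -xn x1.
have nVC : C \subset 'N(V) by apply: fintype.subset_trans nV; apply: finset.subsetT.
have regVC : semiregular V C.
  move=> u /finset.setD1P[x1 /CP xb]; apply/trivgP/fintype.subsetP => v.
  case/finset.setIP=> /VP Ny /cent1P cxy; apply/set1gP; apply: (f_inj); rewrite f1.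
  apply: (@rg_cent (f u) b) => //; first exact: sHG.
  - exact: Ha.
  - by move=> fx1; case/eqP: x1; apply: (f_inj); rewrite fx1.
  by rewrite -fJ conjgE cxy mulKg.
have solC : solvable C.
  apply: (semiregular_solvable abV ntV nVC regVC) => c d /CP cb /CP db oc od.
  have f3 u : #[u] = 3%N -> f u ^+ 3 = 1.
    move=> ox; have <- : f (u ^+ 3) = f u ^+ 3 by rewrite !expgS !expg0 !fM f1.
    by rewrite -ox expg_order.
  apply: (f_inj); rewrite !fM; apply: rg_order3_commute => //; try exact: sHG; try exact: Ha.
  - exact: f3.
  - exact: f3.
have nsV : V <| [set: hT]%SET by rewrite /normal nV finset.subsetT.
rewrite (series_sol nsV) (abelian_sol abV) /=.
have sTCV : [set: hT]%SET / V \subset C / V.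
  rewrite quotientSK //; apply/fintype.subsetP=> u _.
  have [m [Nm Hm mb]] := rg_split sgH sHG Hz (Hf u) (Ha _ (Hf u)).
  have [v vm] := (fP m).1 Hm; rewrite -(normC nVC) -(mulgVK v u).
  apply: mem_mulg; last by apply/VP; rewrite vm.
  by apply/CP; rewrite fM fV vm.
by apply: solvableS sTCV _; apply: (quotient_sol _ solC).
Qed.

(** * Counting involutions in a finite subgroup *)

Section FiniteSubgroup.
Variables (hT : finGroupType) (f : hT -> sym X) (zt : hT).
Hypotheses (f_inj : injective f) (fM : {morph f : u v / u * v}).
Hypotheses (fG : forall u, G (f u)) (fz : f zt = z).
Implicit Types (u v i j : hT).

Let P := [set u | `[< N (f u) >]]%SET.
Let q := #|P|.

Lemma fs1 : f 1 = 1. Proof. by apply: (mulgI (f 1)); rewrite -fM !mulg1. Qed.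
Lemma fsV u : f u^-1 = (f u)^-1.
Proof. by apply: (mulgI (f u)); rewrite -fM !mulgV fs1. Qed.
Lemma fsJ u v : f (u ^ v) = f u ^ f v. Proof. by rewrite !conjgE !fM fsV. Qed.
Lemma fsX u l : f (u ^+ l) = f u ^+ l.
Proof. by elim: l => [|l IH]; rewrite ?expg0 ?fs1 // !expgS fM IH. Qed.
Lemma fsP u : reflect (N (f u)) (u \in P). Proof. by rewrite inE; apply: asboolP. Qed.

Lemma fs_involution j : f j a = a -> j * j = 1 -> j != 1 ->
  (zt * j \in P)%g /\ exists2 m, (m \in P)%g & f j = z ^ f m.
Proof.
move=> ja jj j1; have jj' : f j * f j = 1 by rewrite -fM jj fs1.
have j1' : f j <> 1 by rewrite -fs1 => /f_inj/eqP; rewrite (negPf j1).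
have [Nzj jE] := rg_involution (fG j) ja jj' j1'.
have zjP : zt * j \in P by apply/fsP; rewrite fM fz.
split=> //; exists ((zt * j) ^+ p./2.+1); last by rewrite fsX fM fz.
by apply/fsP; rewrite fsX; apply: rgX; apply/fsP.
Qed.

Lemma fs_adjacent i c : f i a = a -> f i c = c -> i != 1 -> c <> a ->
  exists2 m, (m \in P)%g & f m b = c.
Proof.
move=> ia ic i1 ca; have [n [Nn nb]] := rg_trans ba ca.
have NJ m : N m -> N (m ^ f i) by move=> Nm; apply: rgJ.
(* [psi] is an injective endomorphism of [N], hence permutes the finite group [P]; as [psi n]
   lies in [P], so does [n]. *)
pose psi m := m ^ f i * m^-1.
have Npsi m : N m -> N (psi m) by move=> Nm; apply: rgM; [apply: NJ|apply: rgV].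
have psiM m m' : N m -> N m' -> psi (m * m') = psi m * psi m'.
  move=> Nm Nm'; rewrite {1}/psi conjMg invMg -(mulgA (m ^ f i)) (mulgA (m' ^ f i)).
  by rewrite -/(psi m') (abN (Npsi _ Nm') (rgV Nm)) (mulgA (m ^ f i)).
have psi_inj m m' : N m -> N m' -> psi m = psi m' -> m = m'.
  move=> Nm Nm' e; have Nd : N (m'^-1 * m) by apply: rgM => //; apply: rgV.
  suff d1 : m'^-1 * m = 1 by apply: (mulgI m'^-1); rewrite d1 mulVg.
  apply: (rg_cent (fG i) ia ic ca) => //; first by rewrite -fs1 => /f_inj/eqP; rewrite (negPf i1).
  have Nm'J := NJ _ Nm'; move: e; rewrite /psi => e.
  have -> : (m'^-1 * m) ^ f i = (m' ^ f i)^-1 * (m ^ f i * m^-1) * m by rewrite conjMg conjVg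
    -[RHS]mulgA mulgVK.
  by rewrite e mulKg.
(* [z ^ n] is the only involution fixing [a] and [c], which [f i] fixes. *)
have zi : (z ^ n) ^ f i = z ^ n.
  have zna : (z ^ n) a = a by rewrite -{1}(rg_a Nn) symJ za rg_a.
  have znc : (z ^ n) c = c by rewrite -nb symJ zb.
  have zn2 : z ^ n * z ^ n = 1 by rewrite -conjMg zz conj1g.
  have zn1 : z ^ n <> 1 by move/eqP; rewrite conjg_eq1 => /eqP.
  apply: (@rg_involution_uniq _ (z ^ n) c) => //.
  - by apply: s3J => //; apply: s3J => //; apply: rg_sub.
  - by rewrite -{1}ia symJ zna ia.
  - by rewrite -{1}ic symJ znc ic.
  - by rewrite -conjMg zn2 conj1g.
  - by move/eqP; rewrite conjg_eq1 => /eqP.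
  - by apply: s3J => //; apply: rg_sub.
(* [zt * zt ^ i] maps to the inverse of [psi n * psi n]; the exponent [p./2.+1] extracts the square
   root. *)
have [s sP fs] : exists2 s, (s \in P)%g & f s = psi n.
  pose s := zt * zt ^ i.
  have fsE : f s^-1 = psi n * psi n.
    rewrite -psiM // /psi fsV fM fsJ fz.
    have zE : z = z ^ n * (n * n)^-1 by rewrite rg_Jz // mulgK.
    rewrite {2}zE conjMg zi rg_Jz // conjVg mulgA mulgA zz mul1g.
    by rewrite invMg invgK.
  have fsE' : f (s^-1 ^+ p./2.+1) = psi n.
    rewrite fsX fsE expgMn //; exact: (rg_halfE (Npsi _ Nn)).
  by exists (s^-1 ^+ p./2.+1) => //; apply/fsP; rewrite fsE'; apply: Npsi.
have psiP u : (u \in P)%g -> (u ^ i * u^-1 \in P)%g /\ f (u ^ i * u^-1) = psi (f u).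
  move=> /fsP Nu; have E : f (u ^ i * u^-1) = psi (f u) by rewrite fM fsJ fsV.
  by split=> //; apply/fsP; rewrite E; apply: Npsi.
have imP : [set u ^ i * u^-1 | u in P]%SET = P.
  apply/eqP; rewrite eqEcard; apply/andP; split.
    by apply/fintype.subsetP=> _ /imsetP[u Pu ->]; case: (psiP u Pu).
  rewrite card_in_imset // => u v Pu Pv /(congr1 f).
  rewrite (psiP u Pu).2 (psiP v Pv).2 => /psi_inj e.
  by apply: f_inj; apply: e; apply/fsP.
have /imsetP[m Pm sE] : (s \in [set u ^ i * u^-1 | u in P]%SET)%g by rewrite imP.
exists m => //.
suff fmn : f m = n by rewrite -nb fmn.
apply: psi_inj => //; first exact/fsP.
by rewrite -fs sE (psiP m Pm).2.
Qed.

Variables (oT : finType) (o : oT -> X) (act : hT -> oT -> oT) (a0 : oT).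
Hypotheses (o_inj : injective o) (o_act : forall u e, o (act u e) = f u (o e)).
Hypotheses (o_a0 : o a0 = a) (act_trans : forall e, exists u, act u a0 = e).
Implicit Types e : oT.

Lemma fs_actM u v e : act (u * v) e = act v (act u e).
Proof. by apply: o_inj; rewrite !o_act fM. Qed.
Lemma fs_act1 e : act 1 e = e.
Proof. by apply: o_inj; rewrite o_act fs1. Qed.
Lemma fs_actK u e : act u^-1 (act u e) = e.
Proof. by rewrite -fs_actM mulgV fs_act1. Qed.
Lemma fs_actVK u e : act u (act u^-1 e) = e.
Proof. by rewrite -fs_actM mulVg fs_act1. Qed.
Lemma fs_act_inj u : injective (act u).
Proof. exact: can_inj (fs_actK u). Qed.
Lemma fs_actE u e (e1 : oT) : act u e = e1 -> f u (o e) = o e1.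
Proof. by rewrite -o_act => ->. Qed.

(* [q] is the number of involutions fixing a given point; [adj e] says that some involution
   fixes both [a] and [e]; [J] consists of the involutions that have fixed points. *)
Let inv j := (j * j == 1) && (j != 1).
Let I e := [set j | inv j && (act j e == e)]%SET.
Let J := [set j | inv j && [exists e, act j e == e]]%SET.
Let adj e := [exists m in P, `[< f m b = o e >]].
Let A := [set e | adj e]%SET.
Let Hac e := [set u | (act u a0 == a0) && (act u e == e)]%SET.

Lemma fs_inv_mul u : (u \in P)%g -> inv (zt * u).
Proof.
move=> /fsP Nu; apply/andP; split; first apply/eqP.
  apply: f_inj; rewrite !fM fz fs1 -(mulgA z) (mulgA (f u)) (conjgC (f u)) rg_zJ //.
  by rewrite !mulgA zz mul1g mulVg.
apply/eqP => zu1; apply: z1; apply: rg_sqr1 => //.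
suff -> : z = (f u)^-1 by apply: rgV.
by apply: (mulIg (f u)); rewrite mulVg -fz -fM zu1 fs1.
Qed.

(** Transitivity reduces the count to [a0], where the involutions are the [zt * u] with [u] in
    [P]. *)
Lemma fs_card_I e : #|I e| = q.
Proof.
have [u <-] := act_trans e.
have -> : I (act u a0) = [set j ^ u | j in I a0]%SET.
  apply/setP=> j; apply/idP/imsetP => [|[i]].
    rewrite inE => /andP[/andP[jj j1] /eqP ju]; exists (j ^ u^-1); last by rewrite conjgKV.
    rewrite inE /inv -conjMg (eqP jj) conj1g eqxx conjg_eq1 j1 /=.
    by rewrite conjgE invgK !fs_actM ju fs_actK.
  rewrite !inE => /andP[/andP[ii i1] /eqP ia] ->.
  rewrite /inv -conjMg (eqP ii) conj1g eqxx conjg_eq1 i1 /=.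
  by rewrite conjgE !fs_actM fs_actK ia.
rewrite card_imset; last exact: conjg_inj.
have -> : I a0 = [set (zt * u)%g | u in P]%SET.
  apply/setP=> j; apply/idP/imsetP => [|[i Pi ->]].
    rewrite inE => /andP[/andP[/eqP jj j1] /eqP/fs_actE]; rewrite o_a0 => ja.
    have [zjP _] := fs_involution ja jj j1; exists (zt * j) => //.
    by apply: f_inj; rewrite !fM fz mulgA zz mul1g.
  rewrite inE fs_inv_mul //=; apply/eqP/o_inj; rewrite o_act fM symM fz o_a0 za rg_a //.
  exact/fsP.
by rewrite card_imset //; apply: mulgI.
Qed.

Lemma fs_sum_I : (\sum_e #|I e| = \sum_(j in J) #|[set e | act j e == e]%SET|)%N.
Proof.
under eq_bigr do rewrite -sum1_card.
rewrite (exchange_big_dep (mem J)) /=.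
  apply: eq_bigr => j; rewrite inE => /andP[ij _]; rewrite -sum1_card.
  by apply: eq_bigl => e; rewrite !inE ij.
by move=> e j _; rewrite !inE => /andP[-> jc]; apply/existsP; exists e.
Qed.

Lemma fs_card_fix j : j != 1 -> #|[set e | act j e == e]%SET| <= 2.
Proof.
move=> j1; rewrite leqNgt; apply/negP => /card_gt2P[e [e1 [e2 [[]]]]].
rewrite !inE => /eqP/fs_actE je /eqP/fs_actE je1 /eqP/fs_actE je2 [ee1 e12 e2e].
case/eqP: j1; apply: f_inj; rewrite fs1; apply: (s3_fix _ _ _ _ je je1 je2) => //.
- by move/o_inj/eqP; rewrite (negPf ee1).
- by move/o_inj/esym/eqP; rewrite (negPf e2e).
- by move/o_inj/eqP; rewrite (negPf e12).
Qed.

Lemma fs_sum_J : (\sum_e #|[set j in J | act j a0 == e]%SET| = #|J|)%N.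
Proof.
rewrite -sum1_card (partition_big (fun j => act j a0) predT) //=.
by apply: eq_bigr => e _; rewrite -sum1_card; apply: eq_bigl => j; rewrite inE.
Qed.

(** An involution taking [a0] to [e] swaps the two points, so two such involutions differ by an
    element of [Hac e]. *)
Lemma fs_card_swaps e : e != a0 -> #|[set j in J | act j a0 == e]%SET| <= #|Hac e|.
Proof.
move=> ca; have [->|[j0]] := set_0Vmem [set j in J | act j a0 == e]%SET.
  by rewrite cards0.
rewrite !inE => /andP[/andP[/andP[/eqP jj0 _] _] /eqP ja0].
rewrite -(card_imset _ (@mulgI _ j0)); apply: subset_leq_card.
apply/fintype.subsetP=> _ /imsetP[j + ->].
rewrite !inE => /andP[/andP[/andP[/eqP jj _] _] /eqP ja].
have swap i : (i * i = 1)%g -> act i a0 = e -> act i e = a0.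
  by move=> ii <-; rewrite -fs_actM ii fs_act1.
by rewrite !fs_actM ja0 (swap j) // (swap j0) // ja !eqxx.
Qed.

Lemma fs_HacP e u : (u \in Hac e)%g -> f u a = a /\ f u (o e) = o e.
Proof. by rewrite inE => /andP[/eqP/fs_actE + /eqP/fs_actE]; rewrite o_a0. Qed.

(** By [rg_cent], conjugation by [Hac e] is free on the nontrivial elements of [P]. *)
Lemma fs_card_Hac e : 1 < q -> e != a0 -> #|Hac e| <= q.-1.
Proof.
move=> q1 ca; have /card_gt1P[n1 [n2 [Pn1 Pn2 n12]]] := q1.
have [n Pn ntn] : exists2 n, (n \in P)%g & n != 1.
  have [n11|] := eqVneq n1 1; last by exists n1.
  by exists n2; rewrite // -n11 eq_sym.
have oca : o e <> a by rewrite -o_a0 => /o_inj/eqP; rewrite (negPf ca).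
have -> : q.-1 = #|(P :\ 1)%SET|.
  have P1 : (1 \in P)%g by apply/fsP; rewrite fs1; apply: rg1.
  by rewrite /q (cardsD1 1 P) P1.
rewrite -(@card_in_imset _ _ (fun u => n ^ u)).
  apply: subset_leq_card; apply/fintype.subsetP=> _ /imsetP[u /fs_HacP[ua _] ->].
  rewrite !inE conjg_eq1 ntn /=; apply/asboolP; rewrite fsJ; apply: rgJ => //; exact/fsP.
move=> u v /fs_HacP[ua uc] /fs_HacP[va vc] nuv; apply/eqP; rewrite -divg_eq1;
  apply/negPn/negP=> uv1.
case/eqP: ntn; apply: f_inj; rewrite fs1.
apply: (@rg_cent (f (u * v^-1)) (o e)) => //.
- by rewrite fM fsV symM ua symV_fix.
- by rewrite fM fsV symM uc symV_fix.
- by rewrite -fs1 => /f_inj/eqP; rewrite (negPf uv1).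
- exact/fsP.
by rewrite -fsJ conjgM nuv conjgK.
Qed.

Lemma fs_adjP e : reflect (exists2 m, (m \in P)%g & f m b = o e) (adj e).
Proof. by apply: (iffP exists_inP) => -[m Pm /asboolP]; exists m => //; apply/asboolP. Qed.

Lemma fs_Hac1 e : e != a0 -> ~~ adj e -> #|Hac e| <= 1.
Proof.
move=> ca nadj; rewrite -(cards1 (1 : hT)); apply: subset_leq_card.
apply/fintype.subsetP=> u /fs_HacP[ua uc].
rewrite inE; apply: contraR nadj => u1; apply/fs_adjP; apply: fs_adjacent ua uc u1 _.
by rewrite -o_a0 => /o_inj/eqP; rewrite (negPf ca).
Qed.

Let B := [set e | (e != a0) && ~~ adj e]%SET.

Lemma fs_adj_neq e : adj e -> e != a0.
Proof.
case/fs_adjP => m /fsP Nm mb; apply/eqP => ea; have := rg_moves Nm ba.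
by rewrite mb ea o_a0.
Qed.

Lemma fs_card_split : #|oT| = (#|A| + #|B|).+1.
Proof.
rewrite -cardsT (cardsD1 a0) inE add1n; congr _.+1.
have -> : [set: oT]%SET :\ a0 = (A :|: B)%SET.
  apply/setP=> e; rewrite !inE andbT; have [/fs_adj_neq -> //|nadj] := boolP (adj e).
  by rewrite andbT.
rewrite cardsU; have -> : (A :&: B = finset.set0)%SET; last by rewrite cards0 subn0.
by apply/setP=> e; rewrite !inE; case: (adj e); rewrite ?andbF.
Qed.

(** The involutions are sorted by the image of [a0]: [q] of them fix it, at most [q.-1] take it to a
    given point of [A], and at most one to a given point of [B]. *)
Lemma fs_card_J : 1 < q -> #|J| <= q + #|A| * q.-1 + #|B|.
Proof.
move=> q1; rewrite -fs_sum_J (bigD1 a0) //= -addnA leq_add //.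
  rewrite -(fs_card_I a0); apply: subset_leq_card; apply/fintype.subsetP=> j.
  by rewrite !inE => /andP[/andP[-> _] ->].
rewrite (bigID adj) /= leq_add //.
  rewrite -sum_nat_const [X in _ <= X](eq_bigl (fun e => (e != a0) && adj e)).
    by apply: leq_sum => e /andP[ea _]; apply: leq_trans (fs_card_swaps ea) (fs_card_Hac q1 ea).
  by move=> e; rewrite inE; have [/fs_adj_neq ->|] := boolP (adj e); rewrite ?andbF.
rewrite -[X in _ <= X]sum1_card [X in _ <= X](eq_bigl (fun e => (e != a0) && ~~ adj e));
  last by move=> e; rewrite inE.
by apply: leq_sum => e /andP[ea nadj]; apply: leq_trans (fs_card_swaps ea) (fs_Hac1 ea nadj).
Qed.

Lemma fs_adj_fix u e : act u a0 = a0 -> act u e = e -> u != 1 -> e != a0 -> adj e.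
Proof.
move=> /fs_actE; rewrite o_a0 => ua /fs_actE ue u1 ea; apply/fs_adjP;
  apply: fs_adjacent ua ue u1 _.
by rewrite -o_a0 => /o_inj/eqP; rewrite (negPf ea).
Qed.

(** The involution fixing [a0] and [act u e] is conjugated back by [u]. *)
Lemma fs_adjJ u e : act u a0 = a0 -> adj (act u e) -> adj e.
Proof.
move=> ua aue; have une := fs_adj_neq aue; case/fs_adjP: aue => m Pm mb.
have ne : e != a0 by apply: contraNneq une => ->; rewrite ua.
have za0 : act zt a0 = a0 by apply: o_inj; rewrite o_act fz o_a0.
have ma0 : act m a0 = a0 by apply: o_inj; rewrite o_act o_a0 rg_a //; apply/fsP.
have fixV v (e1 : oT) : act v e1 = e1 -> act v^-1 e1 = e1 by move=> {1}<-; rewrite fs_actK.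
apply: (@fs_adj_fix ((zt ^ m) ^ u^-1)) => //.
- by rewrite !conjgE invgK !fs_actM ua (fixV _ _ ma0) za0 ma0 (fixV _ _ ua).
- have zmu : act (zt ^ m) (act u e) = act u e.
    by apply: o_inj; rewrite o_act -mb fsJ fz symJ zb.
  by rewrite conjgE invgK (fs_actM u) (fs_actM (zt ^ m)) zmu fs_actK.
rewrite !conjg_eq1; apply/eqP => zt1; apply: z1; by rewrite -fz zt1 fs1.
Qed.

(** If [A] has a point, then [b] lies in the orbit, and [A] is its regular orbit under [P]. *)
Lemma fs_card_A : 0 < #|A| -> #|A| = q.
Proof.
case/card_gt0P => e; rewrite inE => /fs_adjP[m Pm mb].
have [b0 ob0] : exists b0, o b0 = b by exists (act m^-1 e); rewrite o_act fsV -mb symK.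
have -> : A = [set act u b0 | u in P]%SET.
  apply/setP=> e1; apply/idP/imsetP => [|[u Pu ->]].
    rewrite inE => /fs_adjP[u Pu ub]; exists u => //.
    by apply: o_inj; rewrite o_act ob0.
  by rewrite inE; apply/fs_adjP; exists u; rewrite // o_act ob0.
rewrite card_in_imset // => u v /fsP Nu /fsP Nv /(congr1 o).
by rewrite !o_act ob0 => /(rg_eq Nu Nv ba)/f_inj.
Qed.

(** The [2 * q] elements of [P] and [zt * P] fix [a0] and take a point of [B] to distinct points of
    [B]: by [fs_adj_fix], only the identity fixes both [a0] and a point not adjacent to it. *)
Lemma fs_card_B : 0 < #|B| -> 2 * q <= #|B|.
Proof.
case/card_gt0P => e; rewrite inE => /andP[ea nadj].
pose M := (P :|: [set zt * u | u in P])%SET.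
have MP u : (u \in M)%g -> act u a0 = a0.
  have PP v : (v \in P)%g -> act v a0 = a0.
    by move=> /fsP Nv; apply: o_inj; rewrite o_act o_a0 rg_a.
  case/finset.setUP => [/PP //|/imsetP[v /PP va ->]]; rewrite fs_actM -{2}va; congr act.
  by apply: o_inj; rewrite o_act fz o_a0.
have -> : (2 * q = #|M|)%N.
  rewrite cardsU card_imset; last exact: mulgI.
  rewrite -/q mul2n addnn; have -> : (P :&: [set zt * u | u in P] = finset.set0)%SET;
    last by rewrite cards0 subn0.
  apply/setP=> u; rewrite [RHS]inE; apply/negP => /finset.setIP[/fsP Nu /imsetP[v /fsP Nv uE]].
  apply: z1; apply: rg_sqr1 => //; suff -> : z = f u * (f v)^-1 by apply: rgM => //; apply: rgV.
  by rewrite uE fM fz mulgK.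
rewrite -(@card_in_imset _ _ (fun u => act u e)).
  apply: subset_leq_card; apply/fintype.subsetP=> _ /imsetP[u /MP ua ->].
  rewrite inE; apply/andP; split; last by apply: contra nadj; apply: fs_adjJ.
  by apply: contra ea => /eqP ue; apply/eqP; apply: (@fs_act_inj u); rewrite ue ua.
move=> u v /MP ua /MP va uve; apply/eqP; rewrite -divg_eq1; apply/negPn/negP => uv1;
  case/negP: nadj; apply: (@fs_adj_fix (u * v^-1)) => //.
  by rewrite fs_actM ua -{1}va fs_actK.
by rewrite fs_actM uve fs_actK.
Qed.

(* Counting pairs (involution, fixed point) gives [#|oT| * q <= 2 * #|J|], where [2] may be
   replaced by [1] when [A] is empty; this is incompatible with [fs_card_J] if [#|B| >= 2 * q]. *)
Lemma fs_all_adjacent e : 3 < q -> e != a0 -> adj e.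
Proof.
move=> q3 ea; apply: contraT => nadj.
have B0 : 0 < #|B| by apply/card_gt0P; exists e; rewrite inE ea.
have q1 : 1 < q by apply: leq_trans q3.
have sumE : (#|oT| * q = \sum_(j in J) #|[set e | act j e == e]%SET|)%N.
  rewrite -fs_sum_I (eq_bigr (fun=> q)) ?sum_nat_const //.
  by move=> e1 _; apply: fs_card_I.
have leJ := fs_card_J q1; have splitO := fs_card_split.
have J1 j : (j \in J)%g -> j != 1 by rewrite inE => /andP[/andP[]].
(* If [A] is empty, each involution has at most one fixed point: one with two, conjugated so as to
   fix [a0], would give a point of [A]. *)
have [A0|A0] := posnP #|A|.
  have : \sum_(j in J) #|[set e | act j e == e]%SET| <= #|J|.
    rewrite -sum1_card; apply: leq_sum => j /J1 j1.
    rewrite leqNgt; apply/negP => /card_gt1P[e1 [e2 []]]; rewrite !inE => /eqP je1 /eqP je2 e12.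
    have [u ue1] := act_trans e1.
    suff : (act u^-1 e2 \in A)%g by apply/negP; rewrite (cards0_eq A0) inE.
    rewrite inE; apply: (@fs_adj_fix (j ^ u^-1)).
    - by rewrite conjgE invgK (fs_actM u) (fs_actM j) ue1 je1 -ue1 fs_actK.
    - by rewrite conjgE invgK (fs_actM u) (fs_actM j) fs_actVK je2.
    - by rewrite conjg_eq1.
    by apply: contra e12 => /eqP; rewrite -{1}(fs_actK u a0) ue1 => /fs_act_inj ->.
  rewrite -sumE splitO A0 => le1; move: leJ; rewrite A0 => leJ.
  have := leq_trans le1 leJ; move: B0 q1; clear; nia.
have oA := fs_card_A A0; have le2B := fs_card_B B0.
have : \sum_(j in J) #|[set e | act j e == e]%SET| <= #|J| * 2.
  by rewrite -sum_nat_const; apply: leq_sum => j /J1; apply: fs_card_fix.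
rewrite -sumE splitO oA => le1; move: leJ; rewrite oA.
(* The bounds amount to [(q - 2) * #|B| <= q * (q - 1)], which contradicts [2 * q <= #|B|] exactly
   when [q > 3]. *)
move: q3 le2B le1; clear; set k := #|B|; set l := #|J|; move: q k l => q' k l; nia.
Qed.

End FiniteSubgroup.

(** * Finite subgroups containing the involutions attached to prescribed points *)

(** The four elements [nn i] give [q > 3], so by [fs_all_adjacent] the points of [O] other than [a]
    are [m b] with [m] in [N :&: H]. The involution [z ^ m] fixes [a] and [m b]; conjugation in [H]
    reaches all other pairs. *)
Lemma rg_orbit (H : set (sym X)) (nn : 'I_4 -> sym X) : is_subgroup H -> H `<=` G ->
  finite_set H ->
    H z -> injective nn -> (forall i, N (nn i) /\ H (nn i)) -> (exists2 h, H h & h a <> a) ->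
  let O := [set x | exists2 h, H h & h a = x] in
  (forall c d, O c -> O d -> c <> d ->
     exists i, [/\ H i, i * i = 1, i <> 1, i c = c & i d = d]) /\
  (forall n, N n -> H n -> O (n b)).
Proof.
move=> sgH sHG finH Hz nn_inj nnP [h Hh ha] O.
have [H1 HM HV] := sgH.
have [hT [f [f_inj fM fP]]] := finite_subgroup_finGroup sgH finH.
have Hf u : H (f u) by apply/fP; exists u.
have fG u : G (f u) by apply: sHG.
have [zt fz] := (fP z).1 Hz.
have finO : finite_set O.
  have -> : O = (fun g : sym X => g a) @` H; last exact: finite_image.
  by apply/seteqP; split=> x [g Hg <-]; exists g.
have [oT [o [o_inj oP]]] := finite_set_finType finO.
have Oo e : O (o e) by apply/oP; exists e.
have OM u x : O x -> O (f u x).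
  by move=> [g Hg <-]; exists (g * f u); first exact: HM.
have act_ex u e : {e1 | o e1 = f u (o e)} by apply/cid/oP/OM.
pose act u e := sval (act_ex u e).
have o_act u e : o (act u e) = f u (o e) by apply: (svalP (act_ex u e)).
have [a0 o_a0] : exists e, o e = a by apply/oP; exists 1.
have act_trans e : exists u, act u a0 = e.
  have [g /fP[u <-] ge] := Oo e; exists u; apply: o_inj.
  by rewrite o_act o_a0.
have q3 : 3 < #|[set u | `[< N (f u) >]]%SET|.
  have /boolp.choice[mm mmP] : forall i, exists u, f u = nn i.
    by move=> i; apply/fP; case: (nnP i).
  have mm_inj : injective mm by move=> i j /(congr1 f); rewrite !mmP => /nn_inj.
  rewrite -{1}[4%N]card_ord -cardsT -(card_imset _ mm_inj); apply: subset_leq_card.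
  by apply/fintype.subsetP=> _ /imsetP[i _ ->]; rewrite inE; apply/asboolP; rewrite mmP;
    case: (nnP i).
have adj := fs_all_adjacent f_inj fM fG fz o_inj o_act o_a0 act_trans q3.
have adjP c : O c -> c <> a -> exists m, [/\ N m, H m & m b = c].
  move=> /oP[e <-] ea; have : e != a0 by apply/eqP => e0; apply: ea; rewrite e0.
  case/adj/exists_inP => m; rewrite inE => /asboolP Nm /asboolP mb.
  by exists (f m).
have zm m : N m -> H m -> [/\ H (z ^ m), z ^ m * z ^ m = 1, z ^ m <> 1,
  (z ^ m) a = a & (z ^ m) (m b) = m b].
  move=> Nm Hm; split.
  - by rewrite conjgE; apply: (HM); [exact: HV | exact: HM].
  - by rewrite -conjMg zz conj1g.
  - by move/eqP; rewrite conjg_eq1 => /eqP.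
  - by rewrite -{1}(rg_a Nm) symJ za rg_a.
  by rewrite symJ zb.
split.
  move=> _ d [g Hg <-] Od; have [k Hk kd] : exists2 k, H k & k a = d by [].
  move=> gd; have ga : g^-1 d <> a by move=> gda; apply: gd; rewrite -gda symVK.
  have [m [Nm Hm mb]] : exists m, [/\ N m, H m & m b = g^-1 d].
    apply: adjP ga; exists (k * g^-1); first by apply: HM; rewrite //; apply: HV.
    by rewrite symM kd.
  have [Hzm zm2 zm1 zma zmb] := zm m Nm Hm.
  exists ((z ^ m) ^ g); split.
  - by rewrite conjgE; apply: (HM); [exact: HV | exact: HM].
  - by rewrite -conjMg zm2 conj1g.
  - by move/eqP; rewrite conjg_eq1 => /eqP.
  - by rewrite symJ zma.
  by rewrite -{1}(symVK g d) symJ -mb zmb mb symVK.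
move=> n Nn Hn; have Oha : O (h a) by exists h.
have [m [Nm Hm mb]] := adjP _ Oha ha.
exists (h * m^-1 * n); first by apply: (HM) => //; apply: (HM) => //; apply: HV.
by rewrite !symM -mb symK.
Qed.

(** [N] is abelian with [n ^+ p = 1] throughout, so adjoining [n] multiplies the group by the powers
    [n ^+ j] with [j < p]. *)
Lemma rg_finite_subgroup (s : seq (sym X)) : (forall n, n \in s -> N n) ->
  exists V : set (sym X), [/\ is_subgroup V, finite_set V, V `<=` N & forall n, n \in s -> V n].
Proof.
elim: s => [|n s IH] Ns.
  exists [set 1]; split=> //; last by move=> _ ->; apply: rg1.
  split=> // [_ _ -> ->|_ ->]; first by rewrite mulg1.
  by rewrite invg1.
have [|V [[V1 VM VV] finV sVN Vs]] := IH.
  by move=> m ms; apply: Ns; rewrite inE ms orbT.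
have Nn : N n by apply: Ns; rewrite inE eqxx.
have p_gt0 : (0 < p)%N by move: p_odd; case: (p).
have nmod j : n ^+ j = n ^+ (j %% p).
  by rewrite {1}(divn_eq j p) expgnDr mulnC expgnA rg_exp // expg1n mul1g.
pose W := [set v * n ^+ j | v in V & j in `I_p].
have WP v j : V v -> W (v * n ^+ j).
  by move=> Vv; exists v => //; exists (j %% p)%N; rewrite /= ?ltn_mod // -nmod.
exists W; split.
- split; first by have := WP 1 0%N V1; rewrite expg0 mulg1.
    move=> _ _ [v Vv [i _ <-]] [v' Vv' [j _ <-]].
    rewrite -mulgA (mulgA (n ^+ i)) (abN (rgX i Nn) (sVN _ Vv')) -(mulgA v') (mulgA v v')
      -expgnDr.
    by apply: WP; apply: VM.
  move=> _ [v Vv [i ip <-]]; rewrite invMg.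
  have -> : (n ^+ i)^-1 = n ^+ (p - i).
    by apply: (mulgI (n ^+ i)); rewrite mulgV -expgnDr subnKC ?rg_exp // ltnW.
  rewrite (abN (rgX _ Nn) (rgV (sVN _ Vv))).
  by apply: WP; apply: VV.
- by apply: finite_image2 => //; apply: finite_II.
- by move=> _ [v Vv [i _ <-]]; apply: rgM; [apply: sVN|apply: rgX].
move=> m; rewrite inE => /orP[/eqP->|ms].
  by have := WP 1 1%N V1; rewrite mul1g expg1.
by have := WP m 0%N (Vs _ ms); rewrite expg0 mulg1.
Qed.

Lemma rg_dihedral (V : set (sym X)) : is_subgroup V -> V `<=` N ->
  is_subgroup (V `|` [set v * z | v in V]).
Proof.
move=> [V1 VM VV] sVN.
have zv v : V v -> z * v = v^-1 * z.
  by move=> Vv; rewrite [RHS]conjgC rg_zJ ?invgK //; apply: rgV; apply: sVN.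
split; first by left.
  move=> u v [Vu|[u' Vu <-]] [Vv|[v' Vv <-]].
  - by left; apply: VM.
  - by right; exists (u * v'); [apply: VM|rewrite mulgA].
  - right; exists (u' * v^-1); first by apply: VM => //; apply: VV.
    by rewrite -(mulgA u' z) zv // mulgA.
  - left; rewrite -mulgA (mulgA z) zv // -(mulgA v'^-1) zz mulg1.
    by apply: VM => //; apply: VV.
move=> u [Vu|[x Vx <-]]; first by left; apply: VV.
right; exists x => //; rewrite invMg.
have -> : z^-1 = z by apply: (mulgI z); rewrite mulgV.
by rewrite zv ?invgK //; apply: VV.
Qed.

Hypothesis stab_finite : forall F : set (sym X),
  is_subgroup F -> F `<=` stabilizer G a -> finite_set F ->
  exists H : set (sym X),
    [/\ is_subgroup H, H `<=` G, finite_set H, ~ is_solvable H & F `<=` H].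
Hypothesis infX : infinite_set [set: X].

Lemma rg_involution_uniq2 c d i j : c <> d -> G i -> i * i = 1 -> i <> 1 -> i c = c -> i d = d ->
  G j -> j * j = 1 -> j <> 1 -> j c = c -> j d = d -> i = j.
Proof.
move=> cd Gi ii i1 ic id Gj jj j1 jc jd.
have [w [wc _]] := s3_third c c.
have [g [Gg ga _]] := s3_ex2 (nesym wc) (nesym ba).
have gda : g d <> a by move=> gda; apply: cd; apply: (@sym_inj _ g); rewrite ga gda.
apply: (@conjg_inj _ g); apply: (@rg_involution_uniq _ _ (g d)) => //; try exact: s3J.
- by rewrite -ga symJ ic.
- by rewrite symJ id.
- by rewrite -conjMg ii conj1g.
- by move/eqP; rewrite conjg_eq1 => /eqP.
- by rewrite -ga symJ jc.
- by rewrite symJ jd.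
- by rewrite -conjMg jj conj1g.
- by move/eqP; rewrite conjg_eq1 => /eqP.
Qed.

(** Conjugated into the stabilizer of [a], the involution becomes [z ^ m], which also fixes
    [m b]. *)
Lemma rg_involution_fix2 c i : G i -> i * i = 1 -> i <> 1 -> i c = c ->
  exists2 d, d <> c & i d = d.
Proof.
move=> Gi ii i1 ic.
have [w [wc _]] := s3_third c c.
have [g [Gg ga _]] := s3_ex2 (nesym wc) (nesym ba).
have iga : (i ^ g) a = a by rewrite -ga symJ ic.
have ig2 : i ^ g * i ^ g = 1 by rewrite -conjMg ii conj1g.
have ig1 : i ^ g <> 1 by move/eqP; rewrite conjg_eq1 => /eqP.
have [Nzi ig] := rg_involution (s3J Gi Gg) iga ig2 ig1.
set m := rg_half _ in ig; have Nm : N m := rg_half_rg Nzi.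
exists (g^-1 (m b)).
  by move=> e; apply: (rg_moves Nm ba); rewrite -ga -e symVK.
by apply: (@sym_inj _ g); rewrite -symJ symVK ig symJ zb.
Qed.

(** [stab_finite] is applied to [V] extended by [z], where the finite group [V] in [N] contains
    elements taking [b] to the points of [E] other than [a]. The resulting [H] moves [a] by
    [rg_solvable], and [O] is the orbit of [a]. *)
Lemma rg_cover (E : set X) : finite_set E -> exists H O : set _,
  [/\ is_subgroup H, H `<=` G & finite_set H] /\
  [/\ finite_set O, forall h x, H h -> O x -> O (h x), E `<=` O &
    forall c d i, O c -> O d -> c <> d -> G i -> i * i = 1 -> i <> 1 -> i c = c -> i d = d ->
      H i].
Proof.
move=> finE; have Na c : exists n, N n /\ (c <> a -> n b = c).
  have [->|ca] := pselect (c = a); first by exists 1; split=> //; apply: rg1.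
  by have [n [Nn nb]] := rg_trans ba ca; exists n.
have [nu nuP] := boolp.choice Na.
(* Four further points secure four elements of [N] in [H], as [rg_orbit] requires. *)
have [e [e_inj ea]] : exists e : 'I_4 -> X, injective e /\ forall i, e i <> a.
  have : infinite_set [set~ a].
    by rewrite -setTD; apply: infinite_setD => //; apply: finite_set1.
  move=> /(@infinite_set_fset {classic X} _ 4)[B sBa B4].
  have ltB (i : 'I_4) : (i < size (enum_fset B))%N := leq_trans (ltn_ord i) B4.
  exists (fun i : 'I_4 => nth (a : {classic X}) (enum_fset B) i); split=> [i j|i].
    move=> eij; apply/val_inj/eqP.
    by rewrite -(nth_uniq (a : {classic X}) (ltB i) (ltB j) (fset_uniq B)); apply/eqP.
  by apply: sBa; apply: mem_nth.
have [fE [eE [_ eEP]]] := finite_set_finType finE.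
pose s := [seq nu (eE i) | i <- enum fE] ++ [seq nu (e i) | i <- enum 'I_4].
have [|V [sgV finV sVN Vs]] := @rg_finite_subgroup s.
  by move=> n; rewrite mem_cat => /orP[] /mapP[i _ ->]; apply: (nuP _).1.
pose F := V `|` [set v * z | v in V].
have sgF : is_subgroup F by apply: rg_dihedral.
have sFa : F `<=` stabilizer G a.
  move=> g [Vv|[v Vv <-]]; split.
  - by apply: rg_sub; apply: sVN.
  - by apply: rg_a; apply: sVN.
  - by apply: s3M => //; apply: rg_sub; apply: sVN.
  by rewrite symM rg_a ?za //; apply: sVN.
have finF : finite_set F by rewrite finite_setU; split => //; apply: finite_image.
have [H [sgH sHG finH nsolH sFH]] := stab_finite sgF sFa finF.
have HV n : n \in s -> N n /\ H n by move=> ns; split; [apply/sVN/Vs|apply: sFH; left; apply: Vs].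
have Hz : H z.
  by apply: sFH; right; exists 1; rewrite ?mul1g //; case: sgV.
have He i : N (nu (e i)) /\ H (nu (e i)).
  by apply: HV; rewrite mem_cat; apply/orP; right; apply: map_f; rewrite mem_enum.
have nu_inj : injective (nu \o e).
  move=> i j /= nuij; apply: e_inj.
  by rewrite -((nuP (e i)).2 (ea i)) -((nuP (e j)).2 (ea j)) nuij.
have [h Hh ha] : exists2 h, H h & h a <> a.
  apply: contrapT => nH; apply: nsolH; have [N0 H0] := He ord0.
  have [j ntj] : exists j, nu (e j) <> 1.
    apply: contrapT => all1; have E1 j : nu (e j) = 1.
      by apply: contrapT => nej; apply: all1; exists j.
    by have /(_ ord0 ord_max) := nu_inj; rewrite /= !E1 => /(_ erefl).
  have [Nj Hj] := He j; apply: (rg_solvable sgH sHG finH _ Hz Hj Nj ntj) => h Hh.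
  by apply: contrapT => ha; apply: nH; exists h.
have [] := rg_orbit sgH sHG finH Hz nu_inj He (ex_intro2 _ _ h Hh ha).
set O := [set x | exists2 h, H h & h a = x] => Oinv ON.
have [H1 HM _] := sgH.
exists H, O; split=> //; split.
- have -> : O = (fun g : sym X => g a) @` H; last exact: finite_image.
  by apply/seteqP; split=> x [g Hg <-]; exists g.
- by move=> g _ Hg [k Hk <-]; exists (k * g); first exact: HM.
- move=> c Ec; have [->|ca] := pselect (c = a); first by exists 1.
  have [i ic] := (eEP c).1 Ec; have [Nc Hc] : N (nu c) /\ H (nu c).
    by apply: HV; rewrite mem_cat -ic map_f // mem_enum.
  by rewrite -((nuP c).2 ca); apply: ON.
move=> c d i Oc Od cd Gi ii i1 ic id.
have [j [Hj jj j1 jc jd]] := Oinv c d Oc Od cd.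
by rewrite (rg_involution_uniq2 cd Gi ii i1 ic id (sHG _ Hj) jj j1 jc jd).
Qed.

(** * The subgroup generated by involutions with fixed points *)

(* Elements that lie in every subgroup containing all involutions with two fixed
   points in a suitable finite set: the normal closure of [z], in a form suited
   to [rg_cover]. *)
Definition rg_core : set (sym X) := [set g | G g /\ exists E : set X, finite_set E /\
  forall H, is_subgroup H -> H `<=` G ->
    (forall c d i, E c -> E d -> c <> d -> G i -> i * i = 1 -> i <> 1 -> i c = c ->
      i d = d -> H i) ->
  H g].
Let A := rg_core.

Lemma rg_core_group : is_subgroup A.
Proof.
split.
- by split; [case: s3_group|exists set0; split=> // H [H1 _ _]].
- move=> g h [Gg [E [finE Eg]]] [Gh [E' [finE' E'h]]]; split; first exact: s3M.
  exists (E `|` E'); split=> [|H sgH sHG EH]; first by rewrite finite_setU.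
  case: (sgH) => _ HM _; apply: HM.
    by apply: Eg => // c d i Ec Ed; apply: EH; left.
  by apply: E'h => // c d i Ec Ed; apply: EH; right.
move=> g [Gg [E [finE Eg]]]; split; first exact: s3V.
by exists E; split=> // H sgH sHG EH; case: (sgH) => _ _; apply; apply: Eg.
Qed.

Lemma rg_core_involution i c : G i -> i * i = 1 -> i <> 1 -> i c = c -> A i.
Proof.
move=> Gi ii i1 ic; split=> //; have [d dc id] := rg_involution_fix2 Gi ii i1 ic.
exists [set c; d]; split=> [|H _ _]; first exact: finite_set2.
by move=> cdH; apply: (cdH c d) => //; [left|right|exact: nesym].
Qed.

Lemma rg_coreJ g h : A g -> G h -> A (g ^ h).
Proof.
move=> [Gg [E [finE Eg]]] Gh; split; first exact: s3J.
exists [set h c | c in E]; split=> [|H [H1 HM HV] sHG EH]; first exact: finite_image.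
apply: (Eg [set k | G k /\ H (k ^ h)] _ _ _).2 => [|k []//|c d i Ec Ed cd Gi ii i1 ic id].
  split=> [|k l [Gk Hk] [Gl Hl]|k [Gk Hk]].
  - by split; [case: s3_group|rewrite conj1g].
  - by split; [apply: s3M|rewrite conjMg; apply: HM].
  - by split; [apply: s3V|rewrite conjVg; apply: HV].
split=> //; apply: (EH (h c) (h d)).
- by exists c.
- by exists d.
- by move=> hcd; apply: cd; apply: (@sym_inj _ h).
- exact: s3J.
- by rewrite -conjMg ii conj1g.
- by move/eqP; rewrite conjg_eq1 => /eqP.
- by rewrite symJ ic.
by rewrite symJ id.
Qed.

(** [rg_cover] is applied to the union of the finite sets attached to the elements of [S]. *)
Lemma rg_core_finite (S : set (sym X)) : finite_set S -> S `<=` A ->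
  exists H, [/\ is_subgroup H, H `<=` G, finite_set H & S `<=` H].
Proof.
move=> finS sSA; have [sT [sS [_ sSP]]] := finite_set_finType finS.
have /boolp.choice[E EP] : forall i : sT, exists E : set X, finite_set E /\
    forall H, is_subgroup H -> H `<=` G ->
    (forall c d i, E c -> E d -> c <> d -> G i -> i * i = 1 -> i <> 1 -> i c = c ->
      i d = d -> H i) ->
    H (sS i).
  by move=> i; have [] : A (sS i) by apply: sSA; apply/sSP; exists i.
have [|H [O [[sgH sHG finH] [_ _ EO HO]]]] := @rg_cover (\bigcup_(i in [set: sT]) E i).
  by apply: bigcup_finite => [|i _]; [exact: finite_finset|case: (EP i)].
exists H; split=> // g /sSP[i <-]; apply: (EP i).2 => // c d j Ec Ed.
by apply: HO; apply: EO; exists i.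
Qed.

(** * The core has index at most two *)

(** Involutions that swap two points and fix a third lie in [A]; two of them bring [g a] and [g b]
    back to [a] and [b]. So cosets of [A] have representatives fixing [a] and [b]. *)
Lemma rg_core_trans2 g : G g -> exists h, [/\ A h, (g * h) a = a & (g * h) b = b].
Proof.
move=> Gg; have [A1 AM _] := rg_core_group.
have move1 c d e : e <> c -> e <> d -> exists h, [/\ A h, h c = d & h e = e].
  move=> ec ed; have [->|cd] := pselect (c = d); first by exists 1.
  have [s [Gs ss sc sd se]] := s3_swap cd (nesym ec) (nesym ed).
  exists s; split=> //; apply: (rg_core_involution Gs ss _ se) => s1.
  by apply: cd; rewrite -sc s1.
have [e [eg ea]] := s3_third (g a) a.
have [h [Ah hga _]] := move1 _ _ _ eg ea.
have gha : a <> (g * h) b.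
  by move=> agh; apply: ba; apply: (@sym_inj _ (g * h)); rewrite -agh symM hga.
have [k [Ak kb ka]] := move1 _ _ _ gha (nesym ba).
exists (h * k); split; first exact: AM.
  by rewrite !symM hga.
exact: kb.
Qed.

(* Let [C = A :&: H_ab] for a large finite [H]. Each [y] in [Y] yields an involution of [A]
   swapping [a] and [b] and fixing [y], and at most two [y] yield the same, so [#|Y| <= 2 * #|C|].
   If [1], [k], [l] represented distinct cosets of [A], the images of [e] under the cosets of [C]
   would give [3 * #|C| <= #|Y|]. *)
Lemma rg_core_stab2 k l : G k -> k a = a -> k b = b -> G l -> l a = a -> l b = b ->
  ~ A k -> ~ A l -> A (k * l^-1).
Proof.
move=> Gk ka kb Gl la lb nAk nAl; apply: contrapT => nAkl.
have [A1 AM AV] := rg_core_group.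
have [e [ea eb]] := s3_third a b.
have [H [O [[[H1 HM HV] sHG finH] [finO OH EO HO]]]] :=
  @rg_cover [set a; b; e; k e; l e] (finite_set5 _ _ _ _ _).
have Oa : O a by apply: EO; do 4!left.
have Ob : O b by apply: EO; do 3!left; right.
have Oe : O e by apply: EO; do 2!left; right.
have Oke : O (k e) by apply: EO; left; right.
have Ole : O (l e) by apply: EO; right.
have ab : a <> b by exact: nesym.
have Hz : H z by apply: (HO a b).
pose C := [set c | [/\ H c, A c, c a = a & c b = b]].
pose Y := O `\` [set a; b].
have finC : finite_set C by apply: sub_finite_set finH => c [].
have finY : finite_set Y by apply: finite_setD.
have [cT [fc [fc_inj fcP]]] := finite_set_finType finC.
have [yT [fy [fy_inj fyP]]] := finite_set_finType finY.
have Cc i : C (fc i) by apply/fcP; exists i.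
have Yy j : Y (fy j) by apply/fyP; exists j.
have Ye g : G g -> g a = a -> g b = b -> O (g e) -> Y (g e).
  move=> Gg ga gb Oge; split=> // -[gea|geb].
    by apply: ea; apply: (@sym_inj _ g); rewrite gea ga.
  by apply: eb; apply: (@sym_inj _ g); rewrite geb gb.
have YC h y : C h -> Y y -> Y (h y).
  move=> [Hh _ ha hb] [Oy nab]; split; first exact: OH.
  move=> [hy|hy]; apply: nab; [left|right]; apply: (@sym_inj _ h); first by rewrite hy ha.
  by rewrite hy hb.
have zY y : Y y -> z y <> y /\ Y (z y).
  move=> Yy'; split.
    move=> zy; case: Yy' => _ nab; apply: z1; apply: (@s3_fix z a b y) => //.
    - by move=> ay; apply: nab; left.
    - by move=> yb; apply: nab; right.
  case: Yy' => Oy nab; split; first exact: OH.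
  move=> [zy|zy]; apply: nab; [left|right]; apply: (@sym_inj _ z); first by rewrite zy za.
  by rewrite zy zb.
(* The involution fixing [y] and [z y] commutes with [z], so it permutes the fixed points [a] and
   [b] of [z]; having no third fixed point, it swaps them. The value [1] outside [Y] is a
   default. *)
have swapY y : exists i, Y y -> [/\ H i /\ A i, i * i = 1, i <> 1, i y = y & [/\ i (z y) = z y,
  i a = b & i b = a]].
  have [Yy'|nY] := pselect (Y y); last by exists 1.
  have [zyy [Ozy nzy]] := zY y Yy'; have [Oy ny] := Yy'.
  have [g [Gg ga gb]] := s3_ex2 ab (nesym zyy); pose i := z ^ g.
  have iy : i y = y by rewrite -ga symJ za.
  have izy : i (z y) = z y by rewrite -gb symJ zb.
  have Gi : G i by apply: s3J.
  have ii : i * i = 1 by rewrite -conjMg zz conj1g.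
  have i1 : i <> 1 by move/eqP; rewrite conjg_eq1 => /eqP.
  clearbody i.
  have iz : i ^ z = i.
    apply: (rg_involution_uniq2 (nesym zyy)) => //.
    - exact: s3J.
    - by rewrite -conjMg ii conj1g.
    - by move/eqP; rewrite conjg_eq1 => /eqP.
    - by rewrite -{1}(involution_swap y zz) symJ izy involution_swap.
    - by rewrite symJ iy.
  have zia : z (i a) = i a by rewrite -{2}za -symJ iz za.
  have ia : i a <> a.
    move=> ia; apply: i1; apply: (@s3_fix i a y (z y)) => //.
    - by move=> ay; apply: ny; left.
    - by move=> azy; apply: nzy; left.
    - exact: nesym.
  have iab : i a = b.
    apply: contrapT => iab; apply: z1; apply: (@s3_fix z a b (i a)) => //; exact: nesym.
  exists i => _; split=> //; last by split=> //; rewrite -iab involution_swap.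
  by split; [apply: (HO y (z y)) => //; exact: nesym | apply: rg_core_involution iy].
have [swp swpP] := boolp.choice swapY.
have [G1 _ _] := s3_group; have [ye ye_e] := (fyP e).1 (Ye 1 G1 erefl erefl Oe).
have iotaC y : Y y -> C (swp e * swp y).
  have Yee : Y e by rewrite -ye_e.
  move=> Yy'; have [[He Ae] _ _ _ [_ ea' eb']] := swpP e Yee.
  have [[Hy Ay] _ _ _ [_ ya yb]] := swpP y Yy'.
  split; [exact: HM|exact: AM|by rewrite symM ea' yb|by rewrite symM eb' ya].
have /boolp.choice[iota iotaP] : forall j : yT, exists i : cT, fc i = swp e * swp (fy j).
  by move=> j; apply/fcP/iotaC.
have cardY : #|yT| <= #|cT| * 2.
  apply: (card_fibers_le (g := iota)) => i; rewrite leqNgt;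
    apply/negP => /card_gt2P[y1 [y2 [y3 [[]]]]].
  rewrite !inE => /eqP y1c /eqP y2c /eqP y3c [y12 y23 y31].
  have same (j j' : yT) : iota j = i -> iota j' = i -> swp (fy j) = swp (fy j').
    by move=> yc yc'; apply: (mulgI (swp e)); rewrite -!iotaP yc yc'.
  have [_ _ s1 sy1 [_ _ _]] := swpP _ (Yy y1).
  have [_ _ _ sy2 _] := swpP _ (Yy y2); have [_ _ _ sy3 _] := swpP _ (Yy y3).
  rewrite -(same y1 y2 y1c y2c) in sy2; rewrite -(same y1 y3 y1c y3c) in sy3.
  apply: s1; apply: (s3_fix _ _ _ _ sy1 sy2 sy3).
  - by move/fy_inj/eqP; rewrite (negPf y12).
  - by move/fy_inj/esym/eqP; rewrite (negPf y31).
  - by move/fy_inj/eqP; rewrite (negPf y23).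
  by have [[+ _] _ _ _ _] := swpP _ (Yy y1); apply: sHG.
pose gj (j : 'I_3) := nth 1 [:: 1; k; l] j.
have gjP j : [/\ G (gj j), gj j a = a, gj j b = b & Y (gj j e)].
  rewrite /gj; case: j => [[|[|[|j]]] jP] //=.
  - by split=> //; apply: (Ye 1).
  - by split=> //; apply: Ye.
  by split=> //; apply: Ye.
have gj_sep j j' : A (gj j * (gj j')^-1) -> j = j'.
  rewrite /gj; case: j => [[|[|[|?]]] ?] //; case: j' => [[|[|[|?]]] ?] //= Ajj;
    try by apply: val_inj.
  - by case: nAk; rewrite -[k]invgK -[k^-1]mul1g; apply: AV.
  - by case: nAl; rewrite -[l]invgK -[l^-1]mul1g; apply: AV.
  - by case: nAk; rewrite invg1 mulg1 in Ajj.
  - by case: nAl; rewrite invg1 mulg1 in Ajj.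
  by case: nAkl; have := AV _ Ajj; rewrite invMg invgK.
have /boolp.choice[theta thetaP] : forall t : 'I_3 * cT, exists j : yT, fy j = fc t.2 (gj t.1 e).
  by move=> t; apply/fyP/YC => //; case: (gjP t.1).
have theta_inj : injective theta.
  move=> [j i] [j' i'] /(congr1 fy); rewrite !thetaP /= => E.
  have [[Hi Ai ia ib] [Hi' Ai' ia' ib']] := (Cc i, Cc i').
  have [[Gj ja jb Yj] [Gj' ja' jb' _]] := (gjP j, gjP j').
  have Egc : gj j * fc i = gj j' * fc i'.
    apply: (@s3_eq _ _ a b e); rewrite ?symM ?ja ?jb ?ja' ?jb' ?ia ?ib ?ia' ?ib' //;
      try exact: nesym.
    - by apply: s3M => //; apply: sHG.
    - by apply: s3M => //; apply: sHG.
  have jj' : j = j'.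
    apply: gj_sep.
    have -> : gj j = gj j' * (fc i' * (fc i)^-1) by rewrite mulgA -Egc mulgK.
    have -> : gj j' * (fc i' * (fc i)^-1) * (gj j')^-1 = (fc i' * (fc i)^-1) ^ (gj j')^-1.
      by rewrite [RHS]conjgE invgK [RHS]mulgA.
    by apply: rg_coreJ; [apply: AM => //; apply: AV|apply: s3V].
  rewrite jj' in Egc *; congr (_, _); apply: fc_inj; apply: (mulgI (gj j')); exact: Egc.
have := leq_card theta theta_inj; rewrite card_prod card_ord.
have : 0 < #|cT|.
  by have [i _] := (fcP 1).1 (And4 H1 A1 erefl erefl); apply/card_gt0P; exists i.
by move: cardY; clear; lia.
Qed.

(** [rg_core_trans2] replaces [g] and [h] by elements of the same cosets fixing [a] and [b], where
    [rg_core_stab2] applies; [A] is normalized by [G]. *)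
Lemma rg_core_index g h : G g -> G h -> ~ A g -> ~ A h -> A (g * h^-1).
Proof.
move=> Gg Gh nAg nAh; have [A1 AM AV] := rg_core_group; have sAG i : A i -> G i by case.
have [i [Ai gia gib]] := rg_core_trans2 Gg; have [j [Aj hja hjb]] := rg_core_trans2 Gh.
have nAgi : ~ A (g * i) by move=> Agi; apply: nAg; rewrite -(mulgK i g); apply: (AM) => //;
  apply: (AV).
have nAhj : ~ A (h * j) by move=> Ahj; apply: nAh; rewrite -(mulgK j h); apply: (AM) => //;
  apply: (AV).
have := rg_core_stab2 (s3M Gg (sAG _ Ai)) gia gib (s3M Gh (sAG _ Aj)) hja hjb nAgi nAhj.
move=> Agihj; have -> : g * h^-1 = (g * i * (h * j)^-1) * (j * i^-1) ^ h^-1.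
  by rewrite conjgE !invMg invgK !mulgA !mulgKV mulgK.
by apply: (AM) => //; apply: rg_coreJ; [apply: (AM) => //; apply: (AV)|apply: s3V].
Qed.

(** If [S] has an element [s] outside [A], a finite group [L] generated by elements of [A] is
    normalized by [s] and contains [s * s]. Then [L] and the coset of the [u * s] form a finite
    group containing [S]. *)
Lemma rg_locally_finite : is_locally_finite G.
Proof.
move=> S finS sSG; have [A1 AM AV] := rg_core_group.
have gen_sub (T K : set (sym X)) : is_subgroup K -> T `<=` K -> Defs.generated T `<=` K.
  by move=> sgK sTK; apply: smallest_sub.
have [sSA|] := pselect (S `<=` A).
  have [H [sgH _ finH sSH]] := rg_core_finite finS sSA.
  by apply: sub_finite_set finH; apply: gen_sub.
move=> nSA; have [s [Ss nAs]] : exists s, S s /\ ~ A s.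
  apply: contrapT => nex; apply: nSA => s Ss; apply: contrapT => nAs.
  by apply: nex; exists s.
have Gs := sSG _ Ss.
have nAsV : ~ A s^-1 by move/AV; rewrite invgK.
(* [W] contains Schreier generators of the intersection of [generated S] with [A]. *)
pose r (t : sym X) := if pselect (A t) then t else t * s^-1.
have Ar t : S t -> A (r t).
  by move=> St; rewrite /r; case: pselect => // nAt; apply: rg_core_index => //; apply: sSG.
pose W0 := [set r t | t in S].
have finW0 : finite_set W0 by apply: finite_image.
have Ass : A (s * s) by rewrite -{2}[s]invgK; apply: rg_core_index => //; apply: s3V.
pose W := W0 `|` [set w ^ s | w in W0] `|` [set s * s].
have finW : finite_set W.
  by rewrite !finite_setU; split; [split=> //; apply: finite_image|apply: finite_set1].
have sWA : W `<=` A.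
  move=> u [[[t St <-]|[w [t St <-] <-]]|->] //; first exact: Ar.
  by apply: rg_coreJ; [apply: Ar|].
have [H [sgH sHG finH sWH]] := rg_core_finite finW sWA.
pose L := Defs.generated W.
have finL : finite_set L by apply: sub_finite_set finH; apply: gen_sub.
have WL : W `<=` L by move=> w Ww K [_]; apply.
have [L1 LM LV] : is_subgroup L.
  split=> [K [[]] //|u v Lu Lv K sWK|u Lu K sWK].
    by case: (sWK) => -[_ + _] _; apply; [apply: Lu|apply: Lv].
  by case: (sWK) => -[_ _ +] _; apply; apply: Lu.
have Lss : L (s * s) by apply: WL; right.
have LsJ : L `<=` [set u | L (u ^ s)].
  apply: gen_sub.
    split=> [|u v Lu Lv|u Lu] /=; first by rewrite conj1g.
      by rewrite conjMg; apply: (LM).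
    by rewrite conjVg; apply: (LV).
  move=> v [[W0v|[u W0u <-]]|->] /=.
  - by apply: WL; left; right; exists v.
  - rewrite -conjgM conjgE; apply: (LM); first exact: LV.
    by apply: (LM) => //; apply: WL; left; left.
  by rewrite conjgE -(mulgA s s s) mulKg.
have LsVJ u : L u -> L (s * u * s^-1).
  move=> Lu; have -> : s * u * s^-1 = (s * s) * (u ^ s) * (s * s)^-1.
    by rewrite conjgE invMg !mulgA !mulgK.
  by apply: (LM); [apply: (LM) => //; apply: (LsJ)|apply: (LV)].
pose K := L `|` [set u * s | u in L].
have finK : finite_set K by rewrite finite_setU; split=> //; apply: finite_image.
apply: sub_finite_set finK; apply: gen_sub; last first.
  move=> t St; have Lr : L (r t) by apply: WL; left; left; exists t.
  move: Lr; rewrite /r; case: pselect => [At|nAt] Lr; first by left.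
  by right; exists (t * s^-1); rewrite ?mulgVK.
split; first by left.
  move=> u v [Lu|[u' Lu <-]] [Lv|[v' Lv <-]].
  - by left; apply: (LM).
  - by right; exists (u * v'); [apply: (LM)|rewrite mulgA].
  - right; exists (u' * (s * v * s^-1)); first by apply: (LM) => //; apply: (LsVJ).
    by rewrite !mulgA mulgVK.
  - left; have -> : u' * s * (v' * s) = u' * (s * v' * s^-1) * (s * s) by rewrite !mulgA mulgVK.
    by apply: (LM) => //; apply: (LM) => //; apply: (LsVJ).
move=> u [Lu|[u' Lu <-]]; first by left; apply: (LV).
right; exists (u'^-1 ^ s * (s * s)^-1).
  by apply: (LM); [apply: (LsJ); apply: (LV)|apply: (LV)].
by rewrite conjgE !invMg !mulgA mulgVK mulgK.
Qed.

End RootGroup.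
End SharplyTriplyTransitive.

(** * The finite case and the conclusion *)

(** An element of [G] is determined by its images of three points. *)
Lemma s3_finite (X : Type) (G : set (sym X)) :
  sharply_triply_transitive G -> finite_set [set: X] -> is_locally_finite G.
Proof.
move=> G3 finX S _ sSG.
have sgG : Defs.generated S `<=` G by apply: smallest_sub => //; apply: s3_group.
apply: sub_finite_set sgG _.
have [_ [c [d [e [cd ce de]]]] _] := G3.
pose ev (g : sym X) := (g c, g d, g e).
have finXXX : finite_set [set: X * X * X].
  by have := finite_setX (finite_setX finX finX) finX; rewrite !setXTT.
have /boolp.choice[r rP] : forall x : X * X * X, exists g, (exists2 k,
  G k & ev k = x) -> G g /\ ev g = x.
  move=> x; have [[k Gk kx]|nk] := pselect (exists2 k, G k & ev k = x); first by exists k.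
  by exists 1.
apply: (@sub_finite_set _ _ (r @` [set: X * X * X])); last exact: finite_image.
move=> g Gg; exists (ev g) => //.
have [|Gr [rc rd re]] := rP (ev g); first by exists g.
exact: (s3_eq G3 cd ce de).
Qed.

Theorem theorem2 (X : Type) (G : set (sym X))
    (G_sharp3 : sharply_triply_transitive G)
    (G_odd : odd_characteristic G)
    (a : X)
    (stab_normal : exists N : set (sym X),
       [/\ is_normal N (stabilizer G a), is_abelian N & is_regular N [set~ a]])
    (stab_finite : forall F : set (sym X),
       is_subgroup F -> F `<=` stabilizer G a -> finite_set F ->
       exists H : set (sym X),
         [/\ is_subgroup H, H `<=` G, finite_set H, ~ is_solvable H & F `<=` H]) :
  is_locally_finite G.
Proof.
have [finX|infX] := pselect (finite_set [set: X]).
  exact: s3_finite.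
have [N [nN abN regN]] := stab_normal.
have [p [p_pr p_odd [a' Gp]]] := G_odd.
(* As [p] is odd, only [Char_odd] is possible. *)
have [[y [g [ya [[Gg ga] gy] /involutionP[gg g1]]]] ordp] :
  (exists y g, [/\ y <> a', stabilizer (stabilizer G a') y g & involution g]) /\
  forall s t, stabilizer G a' s -> stabilizer G a' t -> involution s -> involution t -> s <> t ->
    has_order (s * t) p.
  inversion Gp; subst; last by [].
    by [].
  by split.
have [b [ba _]] := s3_third G_sharp3 a a.
(* [h] carries the involution [g], which fixes [a'] and [y], to one fixing [a] and [b]; conjugation
   by [h^-1] carries the characteristic from [a'] over to [a]. *)
have [h [Gh ha hy]] := s3_ex2 G_sharp3 (nesym ya) (nesym ba).
apply: (@rg_locally_finite X G G_sharp3 a b N (g ^ h) p) => //.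
- exact: s3J.
- by rewrite -ha symJ ga.
- by rewrite -hy symJ gy.
- by rewrite -conjMg gg conj1g.
- by move/eqP; rewrite conjg_eq1 => /eqP.
move=> s t Gs sa ss s1 Gt ta tt t1 st.
have hVa : h^-1 a = a' by rewrite -ha symK.
have conjP i : G i -> i a = a -> i * i = 1 -> i <> 1 ->
    stabilizer G a' (i ^ h^-1) /\ involution (i ^ h^-1).
  move=> Gi ia ii i1; split.
    split; first by apply: s3J => //; apply: s3V.
    by rewrite -hVa symJ ia.
  by apply/involutionP; rewrite -conjMg ii conj1g; split=> // /eqP; rewrite conjg_eq1 => /eqP.
have [sG' s_inv] := conjP s Gs sa ss s1; have [tG' t_inv] := conjP t Gt ta tt t1.
have [|_ + _] := ordp _ _ sG' tG' s_inv t_inv; first by move=> /conjg_inj.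
by rewrite -conjMg -conjXg => /eqP; rewrite conjg_eq1 => /eqP.
Qed.
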